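(* Let $\Lambda\subseteq[0,\infty)$ be an additive semigroup with $0\in\Lambda$, and let $w$ be an admissible weight function on $\Lambda$. Then the group of invertible elements of the Banach algebra $\mathscr{A}_w(\Lambda)$ is $$\mathscr{A}_w^*(\Lambda)=\{a\in\mathscr{A}_w(\Lambda):\ 0\notin\overline{\widetilde a(\mathbb{H})}\}.$$
   Context: $\mathbb{H}=\{s\in\mathbb{C}:\operatorname{Re}s>0\}$. A weight function on $\Lambda$ is a map $w\colon\Lambda\to(0,\infty)$ with $w(0)=1$ and $w(\lambda'+\lambda'')\le w(\lambda')w(\lambda'')$ for all $\lambda',\lambda''\in\Lambda$. It is admissible if (a) $w(\lambda)\ge1$ for all $\lambda\in\Lambda$ and (b) $\lim_{k\to\infty}w(k\lambda)^{1/k}=1$ for all $\lambda\in\Lambda$, where $k\lambda$ denotes the $k$-fold sum. $\mathscr{A}_w(\Lambda)$ is the set of $a\colon\Lambda\to\mathbb{C}$ with $\|a\|_w:=\sum_{\lambda\in\Lambda}|a(\lambda)|w(\lambda)<\infty$, with pointwise linear operations and convolution $(a*b)(\lambda)=\sum_{\lambda'+\lambda''=\lambda}a(\lambda')b(\lambda'')$; it is a commutative unital Banach algebra with unit $\varepsilon=\delta_0$ (where $\delta_\mu(\lambda)=1$ if $\lambda=\mu$ and $0$ otherwise). For $a\in\mathscr{A}_w(\Lambda)$, $\widetilde a(s)=\sum_{\lambda\in\Lambda}a(\lambda)e^{-\lambda s}$ for $s\in\overline{\mathbb{H}}$. *)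

(* Defs.v *)
From Stdlib Require Import Reals List.
Open Scope R_scope.

Definition Cplx : Type := (R * R)%type.
Definition C0 : Cplx := (0, 0).
Definition C1 : Cplx := (1, 0).
Definition Cadd (z u : Cplx) : Cplx := (fst z + fst u, snd z + snd u).
Definition Csub (z u : Cplx) : Cplx := (fst z - fst u, snd z - snd u).
Definition Cmul (z u : Cplx) : Cplx :=
  (fst z * fst u - snd z * snd u, fst z * snd u + snd z * fst u).
Definition Cnorm (z : Cplx) : R := sqrt (fst z * fst z + snd z * snd z).
Definition Re (z : Cplx) : R := fst z.
Definition Cexp_neg (t : R) (s : Cplx) : Cplx :=
  (exp (- t * fst s) * cos (- t * snd s), exp (- t * fst s) * sin (- t * snd s)).

Definition Csum {I : Type} (f : I -> Cplx) (F : list I) : Cplx :=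
  fold_right (fun i acc => Cadd (f i) acc) C0 F.
Definition Rsum {I : Type} (g : I -> R) (F : list I) : R :=
  fold_right (fun i acc => g i + acc) 0 F.

Definition fin_sub {I : Type} (P : I -> Prop) (F : list I) : Prop :=
  NoDup F /\ Forall P F.

Definition has_sum {I : Type} (P : I -> Prop) (f : I -> Cplx) (s : Cplx) : Prop :=
  forall eps, 0 < eps ->
    exists F0, fin_sub P F0 /\
      forall F, fin_sub P F -> incl F0 F -> Cnorm (Csub (Csum f F) s) < eps.

Definition finite_sum_nonneg {I : Type} (P : I -> Prop) (g : I -> R) : Prop :=
  exists M, forall F, fin_sub P F -> Rsum g F <= M.

Definition semigroup0 (Lam : R -> Prop) : Prop :=
  Lam 0 /\ (forall x, Lam x -> 0 <= x) /\ (forall x y, Lam x -> Lam y -> Lam (x + y)).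

Definition weight (Lam : R -> Prop) (w : R -> R) : Prop :=
  (forall l, Lam l -> 0 < w l) /\ w 0 = 1 /\
  (forall l1 l2, Lam l1 -> Lam l2 -> w (l1 + l2) <= w l1 * w l2).

Definition admissible (Lam : R -> Prop) (w : R -> R) : Prop :=
  weight Lam w /\
  (forall l, Lam l -> 1 <= w l) /\
  (forall l, Lam l ->
     Un_cv (fun k => Rpower (w (INR (S k) * l)) (/ INR (S k))) 1).

(** Membership in A_w(Lambda): sum_{l in Lambda} |a l| w l < ∞.
    Elements are functions R -> Cplx; only their values on Lambda matter. *)
Definition in_Aw (Lam : R -> Prop) (w : R -> R) (a : R -> Cplx) : Prop :=
  finite_sum_nonneg Lam (fun l => Cnorm (a l) * w l).

Definition conv_at (Lam : R -> Prop) (a b : R -> Cplx) (l : R) (z : Cplx) : Prop :=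
  has_sum (fun p : R * R => Lam (fst p) /\ Lam (snd p) /\ fst p + snd p = l)
          (fun p => Cmul (a (fst p)) (b (snd p))) z.

Definition delta0 (l : R) : Cplx := if Req_EM_T l 0 then C1 else C0.

Definition invertible_Aw (Lam : R -> Prop) (w : R -> R) (a : R -> Cplx) : Prop :=
  exists b, in_Aw Lam w b /\ forall l, Lam l -> conv_at Lam a b l (delta0 l).

Definition tilde_at (Lam : R -> Prop) (a : R -> Cplx) (s z : Cplx) : Prop :=
  has_sum Lam (fun l => Cmul (a l) (Cexp_neg l s)) z.

Definition tilde_image_H (Lam : R -> Prop) (a : R -> Cplx) (z : Cplx) : Prop :=
  exists s, 0 < Re s /\ tilde_at Lam a s z.

Definition closureC (S : Cplx -> Prop) (z : Cplx) : Prop :=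
  forall eps, 0 < eps -> exists y, S y /\ Cnorm (Csub y z) < eps.

(* Main.v *)
From Stdlib Require Import Reals List FinFun Lra Lia Permutation ClassicalEpsilon Classical.
From Coquelicot Require Import Coquelicot.
Require Import Defs.
Open Scope R_scope.

(* Let [p] be the restriction of [a] to a finite set carrying almost all of its norm, so that
   [|p~|] is bounded below on [Re s > 0] and, [p~] having a bounded derivative, on [Re s >= - et].
   Far to the right [p] is invertible in the algebra with weight [e^{-sg l}], because its constant
   term dominates.  If it is invertible for some [sg], then the mean value of almost periodic
   functions bounds the coefficients of [p^{-n}] by [sup |p~|^{-n} e^{sg l}]; since the exponents lie
   in a finitely generated semigroup, this gives [||p^{-n}|| <= C D^{-n}] for any weight that is
   summable relative to [e^{sg l}], with [C] not depending on [n].  By a Neumann series around [p]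
   the abscissa [sg] can therefore be moved to the left in finitely many steps until [sg = - et],
   where the same bound applies to the subexponential weight [w]; Newman's series
   [sum (p - a)^n p^{-n-1}] then inverts [a].  Only finite exponential sums occur in these steps:
   inverses are replaced by approximate ones, and [a^{-1}] is a limit of approximate inverses of
   finite parts of [a]. *)

(** A lower bound on Re s > 0 only bounds each coefficient of an inverse, and such bounds cannot be
    summed against [w]. A factor e^{-et l} with et > 0 must be gained, hence the passage to the left
    of the imaginary axis. There the transform of [a] may make no sense, but that of a finite
    restriction does. Nor does a lower bound alone yield an expansion of 1/p~ in exponentials. One
    is known far to the right and has to be carried leftwards; since the lower bound and the
    Lipschitz constant are the same at all abscissas, the step length stays fixed.

    The constant C may be large: a Neumann series in d q with powers of q bounded by C D^{-n}
    converges as soon as the norm of d is below D, and C only enters the norm of the result. It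
    depends on the finitely many exponents of p, while the perturbation d may have exponents
    anywhere in [Lam]; so one p serves all larger restrictions, with a common bound on their
    inverses.

    Conversely, an inverse b forces |a~| >= 1/||b||, which is shown with finite sums too. *)

(** * Complex numbers as pairs of reals *)

Definition Copp (z : Cplx) : Cplx := (- fst z, - snd z).
Definition ofR (r : R) : Cplx := (r, 0).
Definition cis (t : R) : Cplx := (cos t, sin t).

Lemma Cplx_ext (z u : Cplx) : fst z = fst u -> snd z = snd u -> z = u.
Proof. destruct z, u; simpl; congruence. Qed.

Lemma Cplx_ring_theory : ring_theory C0 C1 Cadd Cmul Csub Copp eq.
Proof.
  split; intros; apply Cplx_ext; unfold C0, C1, Cadd, Cmul, Csub, Copp; simpl; ring.
Qed.

Add Ring Cplx_ring : Cplx_ring_theory.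

Lemma Cnorm_Cmod (z : Cplx) : Cnorm z = Cmod z.
Proof. unfold Cnorm, Cmod; f_equal; ring. Qed.

Lemma Cnorm_pos (z : Cplx) : 0 <= Cnorm z.
Proof. apply sqrt_pos. Qed.

Lemma Cnorm_add (z u : Cplx) : Cnorm (Cadd z u) <= Cnorm z + Cnorm u.
Proof. rewrite !Cnorm_Cmod; exact (Cmod_triangle z u). Qed.

Lemma Cnorm_mul (z u : Cplx) : Cnorm (Cmul z u) = Cnorm z * Cnorm u.
Proof. rewrite !Cnorm_Cmod; exact (Cmod_mult z u). Qed.

Lemma Cnorm_opp (z : Cplx) : Cnorm (Copp z) = Cnorm z.
Proof. rewrite !Cnorm_Cmod; exact (Cmod_opp z). Qed.

Lemma Csub_opp (z u : Cplx) : Csub z u = Cadd z (Copp u).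
Proof. ring. Qed.

Lemma Cnorm_sub (z u : Cplx) : Cnorm (Csub z u) <= Cnorm z + Cnorm u.
Proof. rewrite Csub_opp, <- (Cnorm_opp u); apply Cnorm_add. Qed.

Lemma Cnorm_sub_sym (z u : Cplx) : Cnorm (Csub z u) = Cnorm (Csub u z).
Proof. rewrite <- Cnorm_opp; f_equal; ring. Qed.

Lemma Cnorm_sub_ge (z u : Cplx) : Cnorm z - Cnorm u <= Cnorm (Csub z u).
Proof.
  assert (H := Cnorm_add (Csub z u) u).
  replace (Cadd (Csub z u) u) with z in H by ring; lra.
Qed.

Lemma Cnorm_C0 : Cnorm C0 = 0.
Proof. rewrite Cnorm_Cmod; exact Cmod_0. Qed.

Lemma Cnorm_C1 : Cnorm C1 = 1.
Proof. rewrite Cnorm_Cmod; exact Cmod_1. Qed.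

Lemma Cnorm_eq0 (z : Cplx) : Cnorm z = 0 -> z = C0.
Proof. rewrite Cnorm_Cmod; exact (Cmod_eq_0 z). Qed.

Lemma Cnorm_ofR (r : R) : Cnorm (ofR r) = Rabs r.
Proof. rewrite Cnorm_Cmod; exact (Cmod_R r). Qed.

Lemma Cnorm_cis (t : R) : Cnorm (cis t) = 1.
Proof.
  unfold Cnorm, cis; simpl; rewrite <- sqrt_1; f_equal.
  generalize (sin2_cos2 t); unfold Rsqr; lra.
Qed.

Lemma Cnorm_fst (z : Cplx) : Rabs (fst z) <= Cnorm z.
Proof.
  rewrite Cnorm_Cmod.
  exact (Rle_trans _ _ _ (Rmax_l _ _) (Rmax_Cmod z)).
Qed.

Lemma Cnorm_snd (z : Cplx) : Rabs (snd z) <= Cnorm z.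
Proof.
  rewrite Cnorm_Cmod.
  exact (Rle_trans _ _ _ (Rmax_r _ _) (Rmax_Cmod z)).
Qed.

Lemma Cnorm_le_abs (z : Cplx) : Cnorm z <= Rabs (fst z) + Rabs (snd z).
Proof.
  replace z with (Cadd (ofR (fst z)) (Cmul (ofR (snd z)) (0, 1))) at 1
    by (apply Cplx_ext; simpl; ring).
  eapply Rle_trans; [apply Cnorm_add|].
  rewrite Cnorm_mul, !Cnorm_ofR.
  replace (Cnorm (0, 1)) with 1; [lra|].
  unfold Cnorm; simpl; rewrite <- sqrt_1; f_equal; rewrite sqrt_1; ring.
Qed.

Lemma Cinv_exists (z : Cplx) : z <> C0 -> exists u, Cmul z u = C1.
Proof. intro H; exists (Cinv z); exact (Cinv_r z H). Qed.

Lemma ofR_add (a b : R) : ofR (a + b) = Cadd (ofR a) (ofR b).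
Proof. apply Cplx_ext; simpl; ring. Qed.

Lemma ofR_mul (a b : R) : ofR (a * b) = Cmul (ofR a) (ofR b).
Proof. apply Cplx_ext; simpl; ring. Qed.

Lemma cis_add (a b : R) : cis (a + b) = Cmul (cis a) (cis b).
Proof. apply Cplx_ext; simpl; [rewrite cos_plus|rewrite sin_plus]; ring. Qed.

Lemma cis_0 : cis 0 = C1.
Proof. unfold cis; now rewrite cos_0, sin_0. Qed.

Lemma cis_PI : cis PI = Copp C1.
Proof. unfold cis, Copp, C1; simpl; rewrite cos_PI, sin_PI; f_equal; ring. Qed.

Lemma Cexp_neg_polar (l sg t : R) :
  Cexp_neg l (sg, t) = Cmul (ofR (exp (- sg * l))) (cis (- l * t)).
Proof.
  unfold Cexp_neg, ofR, cis, Cmul; simpl.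
  replace (- l * sg) with (- sg * l) by ring; f_equal; ring.
Qed.

Lemma Cexp_neg_add (l m : R) (s : Cplx) :
  Cexp_neg (l + m) s = Cmul (Cexp_neg l s) (Cexp_neg m s).
Proof.
  destruct s as [sg t]; rewrite !Cexp_neg_polar.
  replace (- sg * (l + m)) with (- sg * l + - sg * m) by ring.
  replace (- (l + m) * t) with (- l * t + - m * t) by ring.
  rewrite exp_plus, ofR_mul, cis_add; ring.
Qed.

Lemma Cexp_neg_0 (s : Cplx) : Cexp_neg 0 s = C1.
Proof.
  destruct s; rewrite Cexp_neg_polar, Rmult_0_r, exp_0, Ropp_0, Rmult_0_l, cis_0.
  apply Cplx_ext; simpl; ring.
Qed.

Lemma Cnorm_Cexp_neg (l : R) (s : Cplx) : Cnorm (Cexp_neg l s) = exp (- fst s * l).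
Proof.
  destruct s; rewrite Cexp_neg_polar, Cnorm_mul, Cnorm_cis, Cnorm_ofR, Rmult_1_r.
  apply Rabs_right, Rle_ge, Rlt_le, exp_pos.
Qed.

(** * Finite sums over lists *)

Section Sums.
Context {I J : Type}.

Lemma Csum_app (f : I -> Cplx) (F G : list I) :
  Csum f (F ++ G) = Cadd (Csum f F) (Csum f G).
Proof. induction F as [|i F IH]; simpl; [ring|rewrite IH; ring]. Qed.

Lemma Rsum_app (f : I -> R) (F G : list I) : Rsum f (F ++ G) = Rsum f F + Rsum f G.
Proof. induction F as [|i F IH]; simpl; [ring|rewrite IH; ring]. Qed.

Lemma Csum_map (f : I -> Cplx) (g : J -> I) (F : list J) :
  Csum f (map g F) = Csum (fun j => f (g j)) F.
Proof. induction F as [|i F IH]; simpl; [|rewrite IH]; reflexivity. Qed.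

Lemma Rsum_map (f : I -> R) (g : J -> I) (F : list J) :
  Rsum f (map g F) = Rsum (fun j => f (g j)) F.
Proof. induction F as [|i F IH]; simpl; [|rewrite IH]; reflexivity. Qed.

Lemma Csum_flat_map (f : I -> Cplx) (g : J -> list I) (F : list J) :
  Csum f (flat_map g F) = Csum (fun j => Csum f (g j)) F.
Proof. induction F as [|i F IH]; simpl; [|rewrite Csum_app, IH]; reflexivity. Qed.

Lemma Rsum_flat_map (f : I -> R) (g : J -> list I) (F : list J) :
  Rsum f (flat_map g F) = Rsum (fun j => Rsum f (g j)) F.
Proof. induction F as [|i F IH]; simpl; [|rewrite Rsum_app, IH]; reflexivity. Qed.

Lemma Csum_ext (f g : I -> Cplx) (F : list I) :
  (forall i, In i F -> f i = g i) -> Csum f F = Csum g F.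
Proof.
  induction F as [|i F IH]; simpl; intro H; [reflexivity|].
  rewrite IH by auto; rewrite H by auto; reflexivity.
Qed.

Lemma Rsum_ext (f g : I -> R) (F : list I) :
  (forall i, In i F -> f i = g i) -> Rsum f F = Rsum g F.
Proof.
  induction F as [|i F IH]; simpl; intro H; [reflexivity|].
  rewrite IH by auto; rewrite H by auto; reflexivity.
Qed.

Lemma Rsum_le (f g : I -> R) (F : list I) :
  (forall i, In i F -> f i <= g i) -> Rsum f F <= Rsum g F.
Proof.
  induction F as [|i F IH]; simpl; intro H; [lra|].
  apply Rplus_le_compat; auto.
Qed.

Lemma Rsum_nonneg (f : I -> R) (F : list I) :
  (forall i, In i F -> 0 <= f i) -> 0 <= Rsum f F.
Proof.
  induction F as [|i F IH]; simpl; intro H; [lra|].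
  apply Rplus_le_le_0_compat; auto.
Qed.

Lemma Csum_add (f g : I -> Cplx) (F : list I) :
  Csum (fun i => Cadd (f i) (g i)) F = Cadd (Csum f F) (Csum g F).
Proof. induction F as [|i F IH]; simpl; [|rewrite IH]; ring. Qed.

Lemma Rsum_add (f g : I -> R) (F : list I) :
  Rsum (fun i => f i + g i) F = Rsum f F + Rsum g F.
Proof. induction F as [|i F IH]; simpl; [|rewrite IH]; ring. Qed.

Lemma Csum_sub (f g : I -> Cplx) (F : list I) :
  Csum (fun i => Csub (f i) (g i)) F = Csub (Csum f F) (Csum g F).
Proof. induction F as [|i F IH]; simpl; [|rewrite IH]; ring. Qed.

Lemma Rsum_const (c : R) (F : list I) : Rsum (fun _ => c) F = c * INR (length F).
Proof.
  induction F as [|i F IH]; [simpl; ring|].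
  change (length (i :: F)) with (S (length F)); rewrite S_INR; simpl; rewrite IH; ring.
Qed.

Lemma Csum_mul (c : Cplx) (f : I -> Cplx) (F : list I) :
  Csum (fun i => Cmul c (f i)) F = Cmul c (Csum f F).
Proof. induction F as [|i F IH]; simpl; [|rewrite IH]; ring. Qed.

Lemma Rsum_mul (c : R) (f : I -> R) (F : list I) :
  Rsum (fun i => c * f i) F = c * Rsum f F.
Proof. induction F as [|i F IH]; simpl; [|rewrite IH]; ring. Qed.

Lemma Cnorm_Csum (f : I -> Cplx) (F : list I) :
  Cnorm (Csum f F) <= Rsum (fun i => Cnorm (f i)) F.
Proof.
  induction F as [|i F IH]; simpl; [rewrite Cnorm_C0; lra|].
  eapply Rle_trans; [apply Cnorm_add|lra].
Qed.

Lemma Csum_zero (f : I -> Cplx) (F : list I) :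
  (forall i, In i F -> f i = C0) -> Csum f F = C0.
Proof.
  induction F as [|i F IH]; simpl; intro H; [reflexivity|].
  rewrite IH by auto; rewrite H by auto; ring.
Qed.

Lemma Csum_Permutation (f : I -> Cplx) (F G : list I) :
  Permutation F G -> Csum f F = Csum f G.
Proof. induction 1; simpl; [reflexivity| rewrite IHPermutation| |]; try ring; congruence. Qed.

Lemma Rsum_Permutation (f : I -> R) (F G : list I) :
  Permutation F G -> Rsum f F = Rsum f G.
Proof. induction 1; simpl; [reflexivity| rewrite IHPermutation| |]; try ring; congruence. Qed.

Lemma incl_Permutation_app (F G : list I) :
  NoDup F -> incl F G -> exists D, Permutation G (F ++ D).
Proof.
  revert G; induction F as [|i F IH]; intros G HF HG; [now exists G|].
  inversion HF as [|? ? Hi HF']; subst.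
  destruct (in_split i G) as [G1 [G2 ->]]; [apply HG; now left|].
  destruct (IH (G1 ++ G2)) as [D HD]; trivial.
  { intros j Hj. assert (Hj' : In j (G1 ++ i :: G2)) by (apply HG; now right).
    apply in_app_or in Hj'; apply in_or_app.
    destruct Hj' as [|[->|]]; auto; contradiction. }
  exists D; simpl.
  now rewrite <- HD, Permutation_middle.
Qed.

Lemma Rsum_incl (f : I -> R) (F G : list I) :
  NoDup F -> incl F G -> (forall i, In i G -> 0 <= f i) -> Rsum f F <= Rsum f G.
Proof.
  intros HF HG Hf; destruct (incl_Permutation_app F G HF HG) as [D HD].
  rewrite (Rsum_Permutation f _ _ HD), Rsum_app.
  assert (0 <= Rsum f D); [|lra].
  apply Rsum_nonneg; intros i Hi; apply Hf.
  apply (Permutation_in i (Permutation_sym HD)), in_or_app; auto.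
Qed.

Lemma Csum_incl (f : I -> Cplx) (F G : list I) :
  NoDup F -> NoDup G -> incl F G -> (forall i, In i G -> ~ In i F -> f i = C0) ->
  Csum f F = Csum f G.
Proof.
  intros HF HG HFG Hf; destruct (incl_Permutation_app F G HF HFG) as [D HD].
  rewrite (Csum_Permutation f _ _ HD), Csum_app.
  rewrite (Csum_zero f D); [ring|].
  intros i Hi; apply Hf.
  - apply (Permutation_in i (Permutation_sym HD)), in_or_app; auto.
  - intro HiF. apply (Permutation_NoDup HD) in HG.
    destruct (in_split i F HiF) as [F1 [F2 ->]].
    rewrite <- app_assoc in HG; simpl in HG.
    apply NoDup_remove_2 in HG; apply HG.
    rewrite !in_app_iff; auto.
Qed.

End Sums.

Lemma Rsum_list_prod {I J : Type} (f : I -> R) (g : J -> R) (F : list I) (G : list J) :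
  Rsum (fun p => f (fst p) * g (snd p)) (list_prod F G) = Rsum f F * Rsum g G.
Proof.
  induction F as [|i F IH]; simpl; [ring|].
  rewrite Rsum_app, IH, Rsum_map; simpl; rewrite Rsum_mul; ring.
Qed.

Lemma Csum_list_prod {I J : Type} (f : I -> Cplx) (g : J -> Cplx) (F : list I) (G : list J) :
  Csum (fun p => Cmul (f (fst p)) (g (snd p))) (list_prod F G) =
  Cmul (Csum f F) (Csum g G).
Proof.
  induction F as [|i F IH]; simpl; [ring|].
  rewrite Csum_app, IH, Csum_map; simpl; rewrite Csum_mul; ring.
Qed.

Lemma Csum_indicator (m : R) (c : Cplx) (h : R -> Cplx) (E : list R) :
  NoDup E -> In m E ->
  Csum (fun l => Cmul (if Req_EM_T m l then c else C0) (h l)) E = Cmul c (h m).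
Proof.
  intros HE Hm.
  rewrite <- (Csum_incl _ (m :: nil) E); trivial.
  - simpl; destruct (Req_EM_T m m); [ring|congruence].
  - repeat constructor; auto.
  - intros l [<-|[]]; auto.
  - intros l _ Hl; destruct (Req_EM_T m l) as [->|]; [destruct Hl; now left|ring].
Qed.

(** An inequality, since [m] may lie outside [E], where the sum is 0. *)
Lemma Rsum_indicator_le (m b : R) (h : R -> R) (E : list R) :
  NoDup E -> 0 <= b * h m ->
  Rsum (fun l => (if Req_EM_T m l then b else 0) * h l) E <= b * h m.
Proof.
  intros HE Hb; induction HE as [|l E Hl HE IH]; simpl; [lra|].
  destruct (Req_EM_T m l) as [<-|]; [|lra].
  replace (Rsum _ E) with (Rsum (fun _ : R => 0 * 0) E);
    [rewrite Rsum_mul; lra|].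
  apply Rsum_ext; intros k Hk; destruct (Req_EM_T m k) as [<-|]; [contradiction|ring].
Qed.

(** * Exponential polynomials *)

(* The list [x] of pairs [(c, l)] stands for [sum c e^{-l s}]; exponents may repeat. *)
Definition ev (x : list (Cplx * R)) (s : Cplx) : Cplx :=
  Csum (fun e => Cmul (fst e) (Cexp_neg (snd e) s)) x.

Definition nrm (u : R -> R) (x : list (Cplx * R)) : R :=
  Rsum (fun e => Cnorm (fst e) * u (snd e)) x.

Definition coef (x : list (Cplx * R)) (l : R) : Cplx :=
  Csum (fun e => if Req_EM_T (snd e) l then fst e else C0) x.

Definition over (P : R -> Prop) (x : list (Cplx * R)) : Prop :=
  forall e, In e x -> P (snd e).

Definition mulx (x y : list (Cplx * R)) : list (Cplx * R) :=
  flat_map (fun e => map (fun e' => (Cmul (fst e) (fst e'), snd e + snd e')) y) x.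

(* Averaging [f t] and [f (t + PI / m)] kills the frequency [m], fixes the constant term
   and does not increase the supremum. *)
Lemma constant_term_le_sup (y : list (Cplx * R)) (c0 : Cplx) (M : R) :
  (forall e, In e y -> snd e <> 0) ->
  (forall t, Cnorm (Cadd c0 (Csum (fun e => Cmul (fst e) (cis (snd e * t))) y)) <= M) ->
  Cnorm c0 <= M.
Proof.
  remember (length y) as n eqn:Hn; revert y Hn c0 M.
  induction n as [|n IH]; intros [|[c m] y] Hn c0 M Hy HM; try discriminate Hn.
  { cbn in HM; specialize (HM 0).
    now replace (Cadd c0 C0) with c0 in HM by ring. }
  assert (Hm : m <> 0) by exact (Hy _ (or_introl eq_refl)).
  set (h := PI / m).
  (* The factor by which averaging multiplies the frequency [snd e]; it is 0 at [m] because e^{i PI}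
     = -1. *)
  set (k := fun e : Cplx * R => Cmul (ofR (/ 2)) (Cadd C1 (cis (snd e * h)))).
  apply (IH (map (fun e => (Cmul (k e) (fst e), snd e)) y)).
  { rewrite length_map; simpl in Hn; congruence. }
  { intros e He; apply in_map_iff in He; destruct He as [e' [<- He']].
    exact (Hy e' (or_intror He')). }
  intro t; rewrite Csum_map.
  set (f := fun t => Cadd c0 (Csum (fun e => Cmul (fst e) (cis (snd e * t))) ((c, m) :: y))).
  replace (Cadd _ _) with (Cmul (ofR (/ 2)) (Cadd (f t) (f (t + h)))).
  { rewrite Cnorm_mul, Cnorm_ofR, Rabs_right by lra.
    assert (H1 := HM t); assert (H2 := HM (t + h)).
    fold (f t) in H1; fold (f (t + h)) in H2.
    assert (H3 := Cnorm_add (f t) (f (t + h))); lra. }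
  assert (Hhalf : Cadd (ofR (/ 2)) (ofR (/ 2)) = C1)
    by (rewrite <- ofR_add; apply Cplx_ext; simpl; lra).
  unfold f; simpl.
  replace (m * (t + h)) with (m * t + PI) by (unfold h; now field).
  rewrite cis_add, cis_PI.
  rewrite (Csum_ext (fun j => Cmul (Cmul (k j) (fst j)) (cis (snd j * t)))
    (fun j => Cadd (Cmul (ofR (/ 2)) (Cmul (fst j) (cis (snd j * t))))
      (Cmul (ofR (/ 2)) (Cmul (fst j) (cis (snd j * (t + h))))))).
  { rewrite Csum_add, !Csum_mul.
    replace c0 with (Cmul (Cadd (ofR (/ 2)) (ofR (/ 2))) c0) at 3
      by (rewrite Hhalf; ring).
    ring. }
  intros e _; unfold k.
  rewrite Rmult_plus_distr_l, cis_add; ring.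
Qed.

(** Multiplying by e^{l s} on Re s = sg turns the coefficient at [l] into the constant term of a
    trigonometric sum; every other exponent m becomes the nonzero frequency l - m. *)
Lemma ev_line (x : list (Cplx * R)) (l sg : R) :
  exists y, (forall e, In e y -> snd e <> 0) /\
    forall t, Cmul (Cmul (ofR (exp (sg * l))) (cis (l * t))) (ev x (sg, t)) =
      Cadd (coef x l) (Csum (fun e => Cmul (fst e) (cis (snd e * t))) y).
Proof.
  induction x as [|[c m] x [y [Hy IH]]].
  { exists nil; split; [intros e []|]; intro t; unfold ev; simpl; ring. }
  assert (Hcm : forall t, Cmul (Cmul (ofR (exp (sg * l))) (cis (l * t)))
      (Cmul c (Cexp_neg m (sg, t))) =
      Cmul (Cmul c (ofR (exp (sg * (l - m))))) (cis ((l - m) * t))).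
  { intro t; rewrite Cexp_neg_polar.
    replace (sg * (l - m)) with (sg * l + - sg * m) by ring.
    replace ((l - m) * t) with (l * t + - m * t) by ring.
    rewrite exp_plus, ofR_mul, cis_add; ring. }
  unfold ev, coef; simpl; fold (coef x l).
  destruct (Req_EM_T m l) as [->|Hml].
  - exists y; split; trivial; intro t; fold (ev x (sg, t)).
    transitivity (Cadd c (Cmul (Cmul (ofR (exp (sg * l))) (cis (l * t))) (ev x (sg, t))));
      [|rewrite IH; ring].
    assert (H := Hcm t).
    replace (sg * (l - l)) with 0 in H by ring.
    replace ((l - l) * t) with 0 in H by ring.
    rewrite exp_0, cis_0 in H; change (ofR 1) with C1 in H.
    transitivity (Cadd (Cmul (Cmul c C1) C1)
      (Cmul (Cmul (ofR (exp (sg * l))) (cis (l * t))) (ev x (sg, t)))); [|ring].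
    rewrite <- H; ring.
  - exists ((Cmul c (ofR (exp (sg * (l - m)))), l - m) :: y); split.
    { intros e [<-|He]; [simpl; lra|auto]. }
    intro t; fold (ev x (sg, t)); simpl.
    rewrite <- Hcm.
    transitivity (Cadd (Cmul (Cmul (ofR (exp (sg * l))) (cis (l * t)))
      (Cmul c (Cexp_neg m (sg, t))))
      (Cmul (Cmul (ofR (exp (sg * l))) (cis (l * t))) (ev x (sg, t)))); [ring|].
    rewrite IH; ring.
Qed.

(** A Cauchy estimate on a vertical line: sup bounds of powers, which are multiplicative, become
    coefficient bounds. *)
Lemma coef_le_sup (x : list (Cplx * R)) (l sg M : R) :
  (forall t, Cnorm (ev x (sg, t)) <= M) -> Cnorm (coef x l) <= M * exp (sg * l).
Proof.
  intro HM; destruct (ev_line x l sg) as [y [Hy H]].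
  apply (constant_term_le_sup y); trivial; intro t.
  rewrite <- H, !Cnorm_mul, Cnorm_cis, Cnorm_ofR, Rabs_right
    by apply Rle_ge, Rlt_le, exp_pos.
  rewrite Rmult_1_r, Rmult_comm; apply Rmult_le_compat_r; trivial.
  apply Rlt_le, exp_pos.
Qed.

Lemma ev_app (x y : list (Cplx * R)) (s : Cplx) : ev (x ++ y) s = Cadd (ev x s) (ev y s).
Proof. apply Csum_app. Qed.

Lemma coef_app (x y : list (Cplx * R)) (l : R) :
  coef (x ++ y) l = Cadd (coef x l) (coef y l).
Proof. apply Csum_app. Qed.

Definition oppx (x : list (Cplx * R)) : list (Cplx * R) :=
  map (fun e => (Copp (fst e), snd e)) x.

Lemma ev_opp (x : list (Cplx * R)) (s : Cplx) : ev (oppx x) s = Copp (ev x s).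
Proof.
  unfold ev, oppx; rewrite Csum_map; simpl.
  induction x as [|e x IH]; simpl; [|rewrite IH]; ring.
Qed.

Lemma coef_opp (x : list (Cplx * R)) (l : R) : coef (oppx x) l = Copp (coef x l).
Proof.
  unfold coef, oppx; rewrite Csum_map; simpl.
  induction x as [|e x IH]; simpl; [ring|rewrite IH; destruct Req_EM_T; ring].
Qed.

Lemma nrm_opp (u : R -> R) (x : list (Cplx * R)) : nrm u (oppx x) = nrm u x.
Proof.
  unfold nrm, oppx; rewrite Rsum_map; simpl.
  apply Rsum_ext; intros; now rewrite Cnorm_opp.
Qed.

(** The Cauchy estimate with M = 0 for the difference. It recovers coefficients from functions,
    where the list has been forgotten. *)
Lemma coef_unique (x y : list (Cplx * R)) (l : R) :
  (forall s, ev x s = ev y s) -> coef x l = coef y l.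
Proof.
  intro H.
  assert (H0 : coef (x ++ oppx y) l = C0).
  { apply Cnorm_eq0, Rle_antisym; [|apply Cnorm_pos].
    rewrite <- (Rmult_0_l (exp (0 * l))); apply coef_le_sup; intro t.
    rewrite ev_app, ev_opp, H.
    replace (Cadd _ _) with C0 by ring; rewrite Cnorm_C0; lra. }
  rewrite coef_app, coef_opp in H0.
  transitivity (Cadd (Cadd (coef x l) (Copp (coef y l))) (coef y l)); [ring|].
  rewrite H0; ring.
Qed.

Lemma ev_coef (x : list (Cplx * R)) (E : list R) (s : Cplx) :
  NoDup E -> over (fun l => In l E) x ->
  ev x s = Csum (fun l => Cmul (coef x l) (Cexp_neg l s)) E.
Proof.
  intro HE; induction x as [|[c m] x IH]; intro Hx.
  { unfold ev, coef; simpl; symmetry; apply Csum_zero; intros; ring. }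
  unfold ev, coef; simpl; fold (ev x s).
  rewrite IH by (intros e He; apply Hx; now right).
  rewrite <- (Csum_indicator m c (fun l => Cexp_neg l s) E HE (Hx _ (or_introl eq_refl))).
  rewrite <- Csum_add; apply Csum_ext; intros l _; unfold coef; ring.
Qed.

(** Collecting equal exponents cannot raise the norm: each entry of [x] contributes to at most one
    [l] of the duplicate-free [F]. *)
Lemma Rsum_coef_le (P : R -> Prop) (u : R -> R) (x : list (Cplx * R)) (F : list R) :
  (forall l, P l -> 0 <= u l) -> over P x -> (forall l, In l F -> P l) -> NoDup F ->
  Rsum (fun l => Cnorm (coef x l) * u l) F <= nrm u x.
Proof.
  intros Hu Hx HF Hnd; induction x as [|[c m] x IH].
  { unfold nrm, coef; simpl; rewrite Cnorm_C0, Rsum_mul; lra. }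
  unfold nrm; simpl; fold (nrm u x).
  assert (Hc : 0 <= Cnorm c * u m).
  { apply Rmult_le_pos; [apply Cnorm_pos|apply Hu, (Hx _ (or_introl eq_refl))]. }
  assert (IH' := IH (fun e He => Hx e (or_intror He))).
  assert (Hi := Rsum_indicator_le m (Cnorm c) u F Hnd Hc).
  eapply Rle_trans; [|apply Rplus_le_compat; [exact Hi|exact IH']].
  rewrite <- Rsum_add; apply Rsum_le; intros l Hl.
  rewrite <- Rmult_plus_distr_r; apply Rmult_le_compat_r; [auto|].
  unfold coef at 1; simpl; fold (coef x l).
  eapply Rle_trans; [apply Cnorm_add|].
  destruct Req_EM_T; [|rewrite Cnorm_C0]; lra.
Qed.

Lemma coef_notin (P : R -> Prop) (x : list (Cplx * R)) (l : R) :
  over P x -> ~ P l -> coef x l = C0.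
Proof.
  intros Hx Hl; apply Csum_zero; intros e He.
  destruct Req_EM_T as [<-|]; [destruct Hl; auto|reflexivity].
Qed.

Lemma ev_mulx (x y : list (Cplx * R)) (s : Cplx) :
  ev (mulx x y) s = Cmul (ev x s) (ev y s).
Proof.
  unfold ev, mulx; rewrite Csum_flat_map.
  induction x as [|e x IH]; simpl; [ring|].
  rewrite IH, Csum_map; simpl.
  rewrite (Csum_ext _ (fun e' => Cmul (Cmul (fst e) (Cexp_neg (snd e) s))
    (Cmul (fst e') (Cexp_neg (snd e') s)))).
  - rewrite Csum_mul; ring.
  - intros e' _; rewrite Cexp_neg_add; ring.
Qed.

Lemma coef_mulx (x y : list (Cplx * R)) (l : R) :
  coef (mulx x y) l = Csum (fun e => Cmul (fst e) (coef y (l - snd e))) x.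
Proof.
  unfold coef, mulx; rewrite Csum_flat_map.
  apply Csum_ext; intros e _; rewrite Csum_map, <- Csum_mul; simpl.
  apply Csum_ext; intros e' _.
  destruct (Req_EM_T (snd e + snd e') l), (Req_EM_T (snd e') (l - snd e));
    try ring; exfalso; try (apply n; lra).
Qed.

(** * Representations with controlled norm *)

(** Covers [w], the exponential weights e^{-sg l}, which may fall below 1, and their products at
    once. *)
Definition weighted_monoid (P : R -> Prop) (u : R -> R) : Prop :=
  P 0 /\ (forall l m, P l -> P m -> P (l + m)) /\ (forall l, P l -> 0 <= u l) /\
  u 0 = 1 /\ (forall l m, P l -> P m -> u (l + m) <= u l * u m).

(** An exponential sum is treated as a function with a norm bound, so that algebraic identities are
    checked pointwise by [ring] instead of on lists with repeated exponents. *)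
Definition Rep (P : R -> Prop) (u : R -> R) (f : Cplx -> Cplx) (B : R) : Prop :=
  exists x, (forall s, f s = ev x s) /\ over P x /\ nrm u x <= B.

Fixpoint Cpw (z : Cplx) (n : nat) : Cplx :=
  match n with O => C1 | S n => Cmul z (Cpw z n) end.

(** The sum 1 + z + ... + z^{n-1} in Horner form. *)
Fixpoint geo (z : Cplx) (n : nat) : Cplx :=
  match n with O => C0 | S n => Cadd C1 (Cmul z (geo z n)) end.

Lemma geo_eq (z : Cplx) (n : nat) : Cmul (Csub C1 z) (geo z n) = Csub C1 (Cpw z n).
Proof.
  induction n as [|n IH]; simpl; [ring|].
  transitivity (Cadd (Csub C1 z) (Cmul z (Cmul (Csub C1 z) (geo z n)))); [ring|].
  rewrite IH; ring.
Qed.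

Lemma geo_last (z : Cplx) (n : nat) : geo z (S n) = Cadd (geo z n) (Cpw z n).
Proof.
  induction n as [|n IH]; [simpl; ring|].
  change (geo z (S (S n))) with (Cadd C1 (Cmul z (geo z (S n)))).
  rewrite IH at 1; simpl; ring.
Qed.

Lemma Cnorm_Cpw (z : Cplx) (n : nat) : Cnorm (Cpw z n) = Cnorm z ^ n.
Proof. induction n as [|n IH]; simpl; [apply Cnorm_C1|]. now rewrite Cnorm_mul, IH. Qed.

Lemma Cpw_mul (z u : Cplx) (n : nat) : Cpw (Cmul z u) n = Cmul (Cpw z n) (Cpw u n).
Proof. induction n as [|n IH]; simpl; [|rewrite IH]; ring. Qed.

Section RepTheory.
Variables (P : R -> Prop) (u : R -> R).
Hypothesis HPu : weighted_monoid P u.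

Let nrm_pos (x : list (Cplx * R)) : over P x -> 0 <= nrm u x.
Proof.
  intro Hx; apply Rsum_nonneg; intros e He.
  apply Rmult_le_pos; [apply Cnorm_pos|]; apply HPu; auto.
Qed.

Lemma Rep_ext (f g : Cplx -> Cplx) (B : R) :
  (forall s, f s = g s) -> Rep P u f B -> Rep P u g B.
Proof. intros Hfg [x [Hf H]]; exists x; split; trivial; intro s; now rewrite <- Hfg. Qed.

Lemma Rep_le (f : Cplx -> Cplx) (B D : R) : B <= D -> Rep P u f B -> Rep P u f D.
Proof. intros HBD [x [Hf [Hx HB]]]; exists x; repeat split; trivial; lra. Qed.

Lemma Rep_pos (f : Cplx -> Cplx) (B : R) : Rep P u f B -> 0 <= B.
Proof. intros [x [_ [Hx HB]]]; apply Rle_trans with (2 := HB); auto. Qed.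

Lemma Rep_add (f g : Cplx -> Cplx) (B D : R) :
  Rep P u f B -> Rep P u g D -> Rep P u (fun s => Cadd (f s) (g s)) (B + D).
Proof.
  intros [x [Hf [Hx HB]]] [y [Hg [Hy HD]]]; exists (x ++ y); repeat split.
  - intro s; now rewrite ev_app, Hf, Hg.
  - intros e He; apply in_app_or in He; destruct He; auto.
  - unfold nrm; rewrite Rsum_app; now apply Rplus_le_compat.
Qed.

Lemma Rep_opp (f : Cplx -> Cplx) (B : R) :
  Rep P u f B -> Rep P u (fun s => Copp (f s)) B.
Proof.
  intros [x [Hf [Hx HB]]]; exists (oppx x); repeat split.
  - intro s; now rewrite ev_opp, Hf.
  - intros e He; apply in_map_iff in He; destruct He as [e' [<- He']]; simpl; auto.
  - now rewrite nrm_opp.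
Qed.

Lemma Rep_sub (f g : Cplx -> Cplx) (B D : R) :
  Rep P u f B -> Rep P u g D -> Rep P u (fun s => Csub (f s) (g s)) (B + D).
Proof.
  intros Hf Hg; eapply Rep_ext; [|exact (Rep_add _ _ _ _ Hf (Rep_opp _ _ Hg))].
  intro s; simpl; ring.
Qed.

Lemma Rep_const (c : Cplx) : Rep P u (fun _ => c) (Cnorm c).
Proof.
  exists ((c, 0) :: nil); repeat split.
  - intro s; unfold ev; simpl; rewrite Cexp_neg_0; ring.
  - intros e [<-|[]]; apply HPu.
  - unfold nrm; simpl; destruct HPu as [_ [_ [_ [-> _]]]]; lra.
Qed.

Lemma Rep_one : Rep P u (fun _ => C1) 1.
Proof. rewrite <- Cnorm_C1; apply Rep_const. Qed.

Lemma Rep_mul (f g : Cplx -> Cplx) (B D : R) :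
  Rep P u f B -> Rep P u g D -> Rep P u (fun s => Cmul (f s) (g s)) (B * D).
Proof.
  intros [x [Hf [Hx HB]]] [y [Hg [Hy HD]]]; exists (mulx x y); repeat split.
  - intro s; now rewrite ev_mulx, Hf, Hg.
  - intros e He; apply in_flat_map in He; destruct He as [e1 [H1 He]].
    apply in_map_iff in He; destruct He as [e2 [<- H2]].
    apply HPu; auto.
  - apply Rle_trans with (nrm u x * nrm u y); [|apply Rmult_le_compat; auto].
    unfold nrm, mulx; rewrite Rsum_flat_map.
    apply Rle_trans with
      (Rsum (fun e => nrm u y * (Cnorm (fst e) * u (snd e))) x);
      [|rewrite Rsum_mul; unfold nrm; right; ring].
    apply Rsum_le; intros e He; rewrite Rsum_map; simpl.
    unfold nrm; rewrite Rmult_comm, <- Rsum_mul.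
    apply Rsum_le; intros e' He'; rewrite Cnorm_mul.
    replace (_ * _ * (_ * _)) with
      (Cnorm (fst e) * Cnorm (fst e') * (u (snd e) * u (snd e'))) by ring.
    apply Rmult_le_compat_l; [apply Rmult_le_pos; apply Cnorm_pos|].
    apply HPu; auto.
Qed.

Lemma Rep_pow (f : Cplx -> Cplx) (B : R) (n : nat) :
  Rep P u f B -> Rep P u (fun s => Cpw (f s) n) (B ^ n).
Proof.
  intro Hf; induction n as [|n IH]; simpl; [apply Rep_one|].
  now apply Rep_mul.
Qed.

(** The bound does not depend on [n]: it is the fixed point of b -> 1 + B b, the effect of one
    Horner step on norms. *)
Lemma Rep_geo (f : Cplx -> Cplx) (B : R) (n : nat) :
  B < 1 -> Rep P u f B -> Rep P u (fun s => geo (f s) n) (/ (1 - B)).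
Proof.
  intros HB Hf; assert (HB0 := Rep_pos _ _ Hf).
  assert (Hinv : 0 < / (1 - B)) by (apply Rinv_0_lt_compat; lra).
  induction n as [|n IH]; simpl.
  - apply Rep_le with (Cnorm C0); [rewrite Cnorm_C0; lra|apply Rep_const].
  - apply Rep_le with (1 + B * / (1 - B)); [right; field; lra|].
    apply Rep_add; [apply Rep_one|now apply Rep_mul].
Qed.

(** The list witnessing [Rep] may differ from [x]; uniqueness of coefficients transfers its norm
    bound. *)
Lemma Rep_coef (x : list (Cplx * R)) (B : R) (F : list R) :
  over P x -> Rep P u (ev x) B -> NoDup F -> (forall l, In l F -> P l) ->
  Rsum (fun l => Cnorm (coef x l) * u l) F <= B.
Proof.
  intros Hx [y [Hxy [Hy HB]]] HF HFP.
  apply Rle_trans with (2 := HB).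
  rewrite (Rsum_ext _ (fun l => Cnorm (coef y l) * u l))
    by (intros l _; now rewrite (coef_unique x y l Hxy)).
  apply (Rsum_coef_le P); trivial; apply HPu.
Qed.

End RepTheory.

(** The weight e^{-sg l} is exactly the modulus of e^{-l s} on Re s = sg. *)
Lemma Rep_line (P : R -> Prop) (sg B : R) (f : Cplx -> Cplx) (t : R) :
  Rep P (fun l => exp (- sg * l)) f B -> Cnorm (f (sg, t)) <= B.
Proof.
  intros [x [-> [_ HB]]]; apply Rle_trans with (2 := HB).
  eapply Rle_trans; [apply Cnorm_Csum|].
  apply Rsum_le; intros e _; rewrite Cnorm_mul, Cnorm_Cexp_neg; simpl; lra.
Qed.

(** The new norm bound comes from the supremum [M] and the summability constant [C] only, by the
    Cauchy estimate for each coefficient. Applied to powers of a function, it gives a constant [C]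
    common to all powers. *)
Lemma Rep_of_sup (P : R -> Prop) (u v : R -> R) (sg B M C : R) (f : Cplx -> Cplx) :
  (forall l, P l -> 0 <= v l) ->
  (forall F, NoDup F -> (forall l, In l F -> P l) ->
     Rsum (fun l => v l * exp (sg * l)) F <= C) ->
  Rep P u f B -> (forall t, Cnorm (f (sg, t)) <= M) -> Rep P v f (M * C).
Proof.
  intros Hv HC [x [Hf [Hx _]]] HM.
  assert (HM0 : 0 <= M) by exact (Rle_trans _ _ _ (Cnorm_pos _) (HM 0)).
  set (E := nodup Req_EM_T (map snd x)).
  assert (HE : NoDup E) by apply NoDup_nodup.
  assert (HEP : forall l, In l E -> P l).
  { intros l Hl; apply nodup_In, in_map_iff in Hl; destruct Hl as [e [<- He]]; auto. }
  exists (map (fun l => (coef x l, l)) E); repeat split.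
  - intro s; rewrite Hf, (ev_coef x E s HE).
    + unfold ev; now rewrite Csum_map.
    + intros e He; now apply nodup_In, in_map.
  - intros e He; apply in_map_iff in He; destruct He as [l [<- Hl]]; simpl; auto.
  - unfold nrm; rewrite Rsum_map; simpl.
    apply Rle_trans with (Rsum (fun l => M * (v l * exp (sg * l))) E).
    + apply Rsum_le; intros l Hl.
      assert (H := coef_le_sup x l sg M (fun t => eq_ind _ (fun z => Cnorm z <= M) (HM t) _ (Hf _))).
      replace (M * _) with (M * exp (sg * l) * v l) by ring.
      apply Rmult_le_compat_r; auto.
    + rewrite Rsum_mul; apply Rmult_le_compat_l; auto.
Qed.

(** * Summability over finitely generated semigroups *)

Fixpoint Gen (L : list R) (x : R) : Prop :=
  match L with
  | nil => x = 0
  | l :: L => exists k y, Gen L y /\ x = INR k * l + y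
  end.

(** Combinations with all multiplicities below [K], which exhaust [Gen L]. Different multiplicities
    may give the same number; such repetitions only enlarge sums of nonnegative terms. *)
Fixpoint box (L : list R) (K : nat) : list R :=
  match L with
  | nil => 0 :: nil
  | l :: L => flat_map (fun k => map (fun y => INR k * l + y) (box L K)) (seq 0 K)
  end.

Lemma Gen_0 (L : list R) : Gen L 0.
Proof.
  induction L as [|l L IH]; simpl; trivial.
  exists 0%nat, 0; split; [trivial|simpl; ring].
Qed.

Lemma Gen_add (L : list R) (x y : R) : Gen L x -> Gen L y -> Gen L (x + y).
Proof.
  revert x y; induction L as [|l L IH]; simpl; intros x y; [lra|].
  intros [k [x' [Hx ->]]] [j [y' [Hy ->]]].
  exists (k + j)%nat, (x' + y'); split; [auto|rewrite plus_INR; ring].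
Qed.

Lemma Gen_in (L : list R) (l : R) : In l L -> Gen L l.
Proof.
  induction L as [|m L IH]; simpl; [intros []|intros [->|Hl]].
  - exists 1%nat, 0; split; [apply Gen_0|simpl; ring].
  - exists 0%nat, l; split; [auto|simpl; ring].
Qed.

Lemma monoid_mult (P : R -> Prop) (l : R) (k : nat) :
  P 0 -> (forall a b, P a -> P b -> P (a + b)) -> P l -> P (INR k * l).
Proof.
  intros H0 Ha Hl; induction k as [|k IH].
  - simpl; now rewrite Rmult_0_l.
  - rewrite S_INR; replace ((INR k + 1) * l) with (INR k * l + l) by ring; auto.
Qed.

Lemma Gen_sub (P : R -> Prop) (L : list R) (x : R) :
  P 0 -> (forall a b, P a -> P b -> P (a + b)) -> (forall l, In l L -> P l) ->
  Gen L x -> P x.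
Proof.
  intros H0 Ha; revert x; induction L as [|l L IH]; simpl; intros x HL; [now intros ->|].
  intros [k [y [Hy ->]]]; apply Ha; [|apply IH; auto].
  apply monoid_mult; auto.
Qed.

Lemma box_mono (L : list R) (K K' : nat) : (K <= K')%nat -> incl (box L K) (box L K').
Proof.
  intro HK; induction L as [|l L IH]; simpl; intros x Hx; trivial.
  apply in_flat_map in Hx; destruct Hx as [k [Hk Hx]].
  apply in_map_iff in Hx; destruct Hx as [y [<- Hy]].
  apply in_flat_map; exists k; split; [apply in_seq in Hk; apply in_seq; lia|].
  apply (in_map (fun y => INR k * l + y)); auto.
Qed.

Lemma Gen_box (L : list R) (x : R) : Gen L x -> exists K, In x (box L K).
Proof.
  revert x; induction L as [|l L IH]; simpl; intros x Hx; [exists 0%nat; auto|].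
  destruct Hx as [k [y [Hy ->]]]; destruct (IH y Hy) as [K HK].
  exists (S (Nat.max k K)); apply in_flat_map; exists k; split; [apply in_seq; lia|].
  apply (in_map (fun y => INR k * l + y)).
  revert HK; apply box_mono; lia.
Qed.

Lemma Gen_incl_box (L F : list R) :
  (forall x, In x F -> Gen L x) -> exists K, incl F (box L K).
Proof.
  induction F as [|x F IH]; intro HF; [exists 0%nat; intros ? []|].
  destruct IH as [K HK]; [intros; apply HF; now right|].
  destruct (Gen_box L x (HF x (or_introl eq_refl))) as [K' HK'].
  exists (Nat.max K K'); intros y [<-|Hy].
  - revert HK'; apply box_mono; lia.
  - apply HK in Hy; revert Hy; apply box_mono; lia.
Qed.

Lemma Rsum_geometric (r : R) (a n : nat) :
  0 <= r < 1 -> Rsum (fun k => r ^ k) (seq a n) <= r ^ a / (1 - r).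
Proof.
  intro Hr; revert a; induction n as [|n IH]; intro a; simpl.
  - apply Rmult_le_pos; [apply pow_le; lra|apply Rlt_le, Rinv_0_lt_compat; lra].
  - specialize (IH (S a)); simpl in IH.
    replace (r ^ a / (1 - r)) with (r ^ a + r * r ^ a / (1 - r)) by (field; lra); lra.
Qed.

(** Submultiplicativity bounds the sum over a box by a product of geometric series, one for each
    generator. *)
Lemma Gen_summable (P : R -> Prop) (v : R -> R) (L : list R) :
  weighted_monoid P v -> (forall l, In l L -> P l) ->
  (forall l, In l L -> exists D r, 0 <= r < 1 /\ forall k, v (INR k * l) <= D * r ^ k) ->
  exists C, forall F, NoDup F -> (forall l, In l F -> Gen L l) -> Rsum v F <= C.
Proof.
  intros [H0 [Ha [Hv [Hv0 Hm]]]] HL Hg.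
  assert (Hbox : forall K x, In x (box L K) -> P x).
  { intro K; clear Hg; induction L as [|l L IH]; simpl; intros x Hx.
    { now destruct Hx as [<-|[]]. }
    apply in_flat_map in Hx; destruct Hx as [k [_ Hx]].
    apply in_map_iff in Hx; destruct Hx as [y [<- Hy]].
    apply Ha.
    - apply monoid_mult; trivial; apply HL; now left.
    - apply IH; trivial; intros; apply HL; now right. }
  assert (HC : exists C, forall K, Rsum v (box L K) <= C).
  { induction L as [|l L IH]; simpl.
    { exists 1; intros _; lra. }
    (* Multiplicity 0 for [l] embeds [box L K] in [box (l :: L) (S K)]; the successor ensures that 0
       is an allowed multiplicity. *)
    assert (HbL : forall K x, In x (box L K) -> P x).
    { intros K x Hx; apply (Hbox (S K)); simpl.
      apply in_or_app; left; apply in_map_iff; exists x; split; [simpl; ring|].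
      revert Hx; apply box_mono; lia. }
    destruct IH as [C HC]; auto.
    { intros; apply HL; now right. }
    { intros; apply Hg; now right. }
    destruct (Hg l (or_introl eq_refl)) as [D [r [Hr HD]]].
    assert (HD0 : 0 <= D).
    { specialize (HD 0%nat); simpl in HD; rewrite Rmult_0_l, Hv0 in HD; lra. }
    assert (HC0 : 0 <= C).
    { apply Rle_trans with (2 := HC 0%nat), Rsum_nonneg; intros x Hx; eauto. }
    exists (C * (D * (r ^ 0 / (1 - r)))); intro K; rewrite Rsum_flat_map.
    apply Rle_trans with (Rsum (fun k => C * (D * r ^ k)) (seq 0 K)).
    - apply Rsum_le; intros k _; rewrite Rsum_map.
      assert (HPk : P (INR k * l)) by (apply monoid_mult; auto; apply HL; now left).
      apply Rle_trans with (Rsum (fun y => v (INR k * l) * v y) (box L K)).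
      + apply Rsum_le; intros y Hy; apply Hm; eauto.
      + rewrite Rsum_mul, Rmult_comm; apply Rmult_le_compat; auto.
        apply Rsum_nonneg; eauto.
    - rewrite !Rsum_mul; apply Rmult_le_compat_l; trivial.
      apply Rmult_le_compat_l; trivial; now apply Rsum_geometric. }
  destruct HC as [C HC]; exists C; intros F HF HFL.
  destruct (Gen_incl_box L F HFL) as [K HK].
  apply Rle_trans with (2 := HC K), Rsum_incl; trivial; eauto.
Qed.

(** * Approximate inverses *)

Definition expw (sg : R) : R -> R := fun l => exp (- sg * l).

Lemma expw_monoid (P : R -> Prop) (sg : R) :
  P 0 -> (forall a b, P a -> P b -> P (a + b)) -> weighted_monoid P (expw sg).
Proof.
  intros H0 Ha; unfold expw; repeat split; trivial.
  - intros; apply Rlt_le, exp_pos.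
  - now rewrite Rmult_0_r, exp_0.
  - intros l m _ _; rewrite Rmult_plus_distr_l, exp_plus; lra.
Qed.

(** An error below 1 means invertibility in the completed algebra, expressed by a finite sum [q].
    The size of [B] is left open, since later bounds come from values on the line. *)
Definition approx_invertible (P : R -> Prop) (sg : R) (p : Cplx -> Cplx) : Prop :=
  exists q B th, th < 1 /\ Rep P (expw sg) q B /\
    Rep P (expw sg) (fun s => Csub C1 (Cmul (p s) (q s))) th.

Section Neumann.
Variables (P : R -> Prop) (u : R -> R).
Hypothesis HPu : weighted_monoid P u.

(** Here the norm of [z] may exceed 1 and only its high powers decay, so a term-by-term bound takes
    the place of [Rep_geo]. *)
Lemma Rep_mul_geo (g z : Cplx -> Cplx) (A : R) (m : nat) :
  (forall j, Rep P u (fun s => Cmul (g s) (Cpw (z s) j)) (A * (/ 2) ^ j)) ->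
  Rep P u (fun s => Cmul (g s) (geo (z s) m)) (2 * A).
Proof.
  intro H.
  assert (HA : 0 <= A).
  { assert (H0 := Rep_pos P u HPu _ _ (H 0%nat)); simpl in H0; lra. }
  (* The exact geometric partial sum makes the induction close. *)
  assert (H2 : Rep P u (fun s => Cmul (g s) (geo (z s) m)) (2 * A * (1 - (/ 2) ^ m))).
  { induction m as [|m IH].
    - apply Rep_le with (Cnorm C0); [rewrite Cnorm_C0; simpl; lra|].
      eapply Rep_ext; [|exact (Rep_const P u HPu C0)]; intro s; simpl; ring.
    - apply Rep_le with (2 * A * (1 - (/ 2) ^ m) + A * (/ 2) ^ m); [simpl; lra|].
      eapply Rep_ext; [|exact (Rep_add P u _ _ _ _ IH (H m))].
      intro s; cbv beta; rewrite geo_last; ring. }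
  revert H2; apply Rep_le.
  assert (0 <= (/ 2) ^ m) by (apply pow_le; lra); nra.
Qed.

(* [G = Q sum_(j<m) (dQ)^j], so that [(p - d) G = 1 - (dQ)^m - (1 - pQ) sum_(j<m) (dQ)^j]. *)
Lemma perturbed_inverse (p d Q : Cplx -> Cplx) (ka be C eps : R) :
  0 <= be -> ka * be <= / 2 -> 2 * C * eps <= / 4 ->
  Rep P u (fun s => Csub C1 (Cmul (p s) (Q s))) eps ->
  (forall j, Rep P u (fun s => Cpw (Q s) j) (C * be ^ j)) ->
  Rep P u d ka ->
  exists G, Rep P u G (2 * (C * be)) /\
    Rep P u (fun s => Csub C1 (Cmul (Csub (p s) (d s)) (G s))) (/ 2).
Proof.
  intros Hbe Hkb HCe He HQ Hd.
  assert (Hka : 0 <= ka) by exact (Rep_pos P u HPu _ _ Hd).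
  assert (HC : 0 <= C).
  { assert (H0 := Rep_pos P u HPu _ _ (HQ 0%nat)); simpl in H0; lra. }
  assert (Hpow : forall j, ka ^ j * be ^ j <= (/ 2) ^ j).
  { intro j; rewrite <- Rpow_mult_distr; apply pow_incr; split; [nra|trivial]. }
  assert (HdQ : forall j, Rep P u (fun s => Cpw (Cmul (d s) (Q s)) j) (C * (/ 2) ^ j)).
  { intro j; apply Rep_le with (ka ^ j * (C * be ^ j)).
    { replace (_ * (_ * _)) with (C * (ka ^ j * be ^ j)) by ring.
      now apply Rmult_le_compat_l. }
    eapply Rep_ext; [|exact (Rep_mul P u HPu _ _ _ _ (Rep_pow P u HPu d ka j Hd) (HQ j))].
    intro s; cbv beta; now rewrite Cpw_mul. }
  (* The truncation error and the error 2 C eps inherited from [Q] get 1/4 each; C + 1 in the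
     threshold avoids dividing by 0. *)
  assert (Hm : exists m, C * (/ 2) ^ m <= / 4).
  { destruct (pow_lt_1_zero (/ 2)) with (y := / (4 * (C + 1))) as [m Hm].
    { rewrite Rabs_right; lra. }
    { apply Rinv_0_lt_compat; lra. }
    exists m; specialize (Hm m (le_n m)).
    rewrite Rabs_right in Hm by (apply Rle_ge, pow_le; lra).
    apply Rle_trans with ((C + 1) * / (4 * (C + 1))); [|right; field; lra].
    apply Rmult_le_compat; try lra; apply pow_le; lra. }
  destruct Hm as [m Hm].
  exists (fun s => Cmul (Q s) (geo (Cmul (d s) (Q s)) m)); split.
  - apply Rep_mul_geo; intro j.
    apply Rep_le with (ka ^ j * (C * be ^ S j)).
    { simpl; replace (_ * (C * _)) with (C * be * (ka ^ j * be ^ j)) by ring.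
      apply Rmult_le_compat_l; [nra|trivial]. }
    eapply Rep_ext;
      [|exact (Rep_mul P u HPu _ _ _ _ (Rep_pow P u HPu d ka j Hd) (HQ (S j)))].
    intro s; simpl; rewrite Cpw_mul; ring.
  - assert (Hgeo : Rep P u (fun s => geo (Cmul (d s) (Q s)) m) (2 * C)).
    { eapply Rep_ext; [|apply (Rep_mul_geo (fun _ => C1) (fun s => Cmul (d s) (Q s)) C m)].
      - intro s; simpl; ring.
      - intro j; eapply Rep_ext; [|apply (HdQ j)]; intro s; simpl; ring. }
    apply Rep_le with (C * (/ 2) ^ m + eps * (2 * C)); [lra|].
    eapply Rep_ext;
      [|exact (Rep_add P u _ _ _ _ (HdQ m) (Rep_mul P u HPu _ _ _ _ He Hgeo))].
    intro s; cbv beta.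
    assert (H := geo_eq (Cmul (d s) (Q s)) m).
    transitivity (Cadd (Csub C1 (Cmul (Csub C1 (Cmul (d s) (Q s))) (geo (Cmul (d s) (Q s)) m)))
      (Cmul (Csub C1 (Cmul (p s) (Q s))) (geo (Cmul (d s) (Q s)) m))); [|ring].
    rewrite H; ring.
Qed.

End Neumann.

(* An approximate inverse [Q] of [p] for the weight [exp (- sg l)] satisfies
   [|Q^j| <= (2/D)^j] on the line [Re s = sg]; this bounds its coefficients, hence its norm for
   any weight [u] that is summable relative to [exp (- sg l)], with a constant not depending on [j]. *)
Lemma change_of_weight (P Lam : R -> Prop) (u : R -> R) (sg C D : R) (p : Cplx -> Cplx) :
  weighted_monoid Lam u -> weighted_monoid P (expw sg) -> (forall l, P l -> Lam l) ->
  (forall F, NoDup F -> (forall l, In l F -> P l) ->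
     Rsum (fun l => u l * exp (sg * l)) F <= C) ->
  0 < D -> (forall t, D <= Cnorm (p (sg, t))) ->
  approx_invertible P sg p ->
  forall d, Rep Lam u d (D / 4) ->
  exists G, Rep Lam u G (4 * C / D) /\
    Rep Lam u (fun s => Csub C1 (Cmul (Csub (p s) (d s)) (G s))) (/ 2).
Proof.
  intros Hu HP HPL HC HD Hp [q [B [th [Hth [Hq Hr]]]]] d Hd.
  assert (HuP : forall l, P l -> 0 <= u l) by (intros; apply Hu; auto).
  assert (Hup : forall f E M, Rep P (expw sg) f E -> (forall t, Cnorm (f (sg, t)) <= M) ->
            Rep Lam u f (M * C)).
  { intros f E M Hf HM.
    destruct (Rep_of_sup P (expw sg) u sg E M C f HuP HC Hf HM) as [x [H1 [H2 H3]]].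
    exists x; repeat split; trivial; intros e He; auto. }
  (* The sum over the single exponent 0 is already 1. *)
  assert (HC1 : 1 <= C).
  { assert (H := HC (0 :: nil)); simpl in H.
    destruct Hu as [_ [_ [_ [Hu0 _]]]].
    rewrite Rmult_0_r, exp_0, Hu0 in H.
    rewrite <- (Rmult_1_l 1), <- (Rplus_0_r (1 * 1)); apply H.
    - repeat constructor; auto.
    - intros l [<-|[]]; apply HP. }
  (* An error [eps] on the line becomes norm eps C for the weight [u], and [perturbed_inverse] asks
     for 2 C (eps C) <= 1/4. *)
  set (eps := / (8 * (C * C))).
  assert (Heps : 0 < eps) by (apply Rinv_0_lt_compat; nra).
  assert (Heps1 : eps <= 1).
  { unfold eps; rewrite <- Rinv_1; apply Rinv_le_contravar; nra. }
  assert (Hth0 : 0 <= th) by exact (Rep_pos P _ HP _ _ Hr).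
  destruct (pow_lt_1_zero th) with (y := eps) as [n Hn]; trivial.
  { rewrite Rabs_right; lra. }
  specialize (Hn n (le_n n)); rewrite Rabs_right in Hn by (apply Rle_ge, pow_le; lra).
  set (r := fun s => Csub C1 (Cmul (p s) (q s))).
  (* Then 1 - p Q = r^n is at most [eps] <= 1 on the line, so |p Q| <= 2 and |Q| <= 2/D there. With
     the norm of [d] at most D/4, the ratio of the Neumann series is 1/2. *)
  set (Q := fun s => Cmul (q s) (geo (r s) n)).
  assert (HpQ : forall s, Csub C1 (Cmul (p s) (Q s)) = Cpw (r s) n).
  { intro s; unfold Q.
    transitivity (Csub C1 (Cmul (Csub C1 (r s)) (geo (r s) n))); [unfold r; ring|].
    rewrite geo_eq; ring. }
  assert (HrR : Rep P (expw sg) (fun s => Cpw (r s) n) (th ^ n))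
    by (apply Rep_pow; trivial).
  assert (Hrn : forall t, Cnorm (Cpw (r (sg, t)) n) <= eps).
  { intro t; apply Rle_trans with (th ^ n); [|lra].
    exact (Rep_line P sg _ _ t HrR). }
  assert (HQR : Rep P (expw sg) Q (B * / (1 - th)))
    by (apply Rep_mul; trivial; now apply Rep_geo).
  assert (HQl : forall t, Cnorm (Q (sg, t)) <= 2 / D).
  { intro t.
    assert (H : D * Cnorm (Q (sg, t)) <= 2).
    { apply Rle_trans with (Cnorm (Cmul (p (sg, t)) (Q (sg, t)))).
      - rewrite Cnorm_mul; apply Rmult_le_compat_r; [apply Cnorm_pos|trivial].
      - replace (Cmul _ _) with (Csub C1 (Cpw (r (sg, t)) n)) by (rewrite <- HpQ; ring).
        eapply Rle_trans; [apply Cnorm_sub|].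
        specialize (Hrn t); rewrite Cnorm_C1; lra. }
    apply Rmult_le_reg_l with D; trivial.
    replace (D * (2 / D)) with 2 by (field; lra); trivial. }
  destruct (perturbed_inverse Lam u Hu p d Q (D / 4) (2 / D) C (eps * C)) as [G [HG1 HG2]];
    trivial.
  - apply Rlt_le, Rdiv_lt_0_compat; lra.
  - right; field; lra.
  - right; unfold eps; field; lra.
  - apply Rep_ext with (fun s => Cpw (r s) n); [intro; now rewrite HpQ|].
    eapply Hup; [exact HrR|trivial].
  - intro j; rewrite Rmult_comm; eapply Hup; [apply Rep_pow; trivial; exact HQR|].
    intro t; cbv beta; rewrite Cnorm_Cpw; apply pow_incr; split; [apply Cnorm_pos|trivial].
  - exists G; split; trivial.
    replace (4 * C / D) with (2 * (C * (2 / D))) by (field; lra); trivial.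
Qed.

(** * Moving the abscissa *)

Definition shift (c : R) (s : Cplx) : Cplx := (fst s - c, snd s).

(** Translation multiplies the coefficient at l by e^{c l}, which the change of weight cancels: it
    is an isometry. *)
Lemma Rep_shift (P : R -> Prop) (a c B : R) (f : Cplx -> Cplx) :
  Rep P (expw a) f B -> Rep P (expw (a + c)) (fun s => f (shift c s)) B.
Proof.
  intros [x [Hf [Hx HB]]].
  exists (map (fun e => (Cmul (ofR (exp (c * snd e))) (fst e), snd e)) x); repeat split.
  - intro s; rewrite Hf; unfold ev; rewrite Csum_map; simpl.
    apply Csum_ext; intros e _; destruct s as [sg t]; unfold shift; simpl.
    rewrite !Cexp_neg_polar.
    replace (- (sg - c) * snd e) with (c * snd e + - sg * snd e) by ring.
    rewrite exp_plus, ofR_mul; ring.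
  - intros e He; apply in_map_iff in He; destruct He as [e' [<- He']]; simpl; auto.
  - apply Rle_trans with (2 := HB); right; unfold nrm; rewrite Rsum_map; simpl.
    apply Rsum_ext; intros e _; unfold expw.
    rewrite Cnorm_mul, Cnorm_ofR, Rabs_right by apply Rle_ge, Rlt_le, exp_pos.
    replace (- a * snd e) with (c * snd e + - (a + c) * snd e) by ring.
    rewrite exp_plus; ring.
Qed.

(** Since e^{-a l} <= e^l for a >= -1, the one Lipschitz constant l e^l serves all abscissas that
    occur. *)
Lemma exp_neg_diff (a b l : R) : -1 <= a <= b -> 0 <= l ->
  0 <= exp (- a * l) - exp (- b * l) <= (b - a) * (l * exp l).
Proof.
  intros Hab Hl; split.
  - assert (H : exp (- b * l) <= exp (- a * l)); [|lra].
    destruct (Req_dec (- b * l) (- a * l)) as [->|]; [lra|].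
    apply Rlt_le, exp_increasing; nra.
  - assert (H1 := exp_ineq1_le (- (b - a) * l)).
    replace (- b * l) with (- (b - a) * l + - a * l) by ring; rewrite exp_plus.
    assert (H2 : exp (- a * l) <= exp l).
    { destruct (Req_dec (- a * l) l) as [->|]; [lra|].
      apply Rlt_le, exp_increasing; nra. }
    assert (H3 := exp_pos (- a * l)).
    apply Rle_trans with ((b - a) * l * exp (- a * l)).
    + replace (exp (- a * l) - _) with ((1 - exp (- (b - a) * l)) * exp (- a * l)) by ring.
      apply Rmult_le_compat_r; lra.
    + rewrite <- Rmult_assoc; apply Rmult_le_compat_l; [nra|trivial].
Qed.

Lemma ev_horizontal (x : list (Cplx * R)) (a b t : R) :
  over (fun l => 0 <= l) x -> -1 <= a <= b ->
  Cnorm (Csub (ev x (a, t)) (ev x (b, t))) <= (b - a) * nrm (fun l => l * exp l) x.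
Proof.
  intros Hx Hab.
  replace (Csub _ _) with
    (Csum (fun e => Cmul (Cmul (fst e) (cis (- snd e * t)))
      (ofR (exp (- a * snd e) - exp (- b * snd e)))) x).
  - eapply Rle_trans; [apply Cnorm_Csum|].
    unfold nrm; rewrite <- Rsum_mul; apply Rsum_le; intros e He.
    assert (H := exp_neg_diff a b (snd e) Hab (Hx e He)).
    rewrite !Cnorm_mul, Cnorm_cis, Cnorm_ofR, Rabs_right by lra.
    assert (H0 := Cnorm_pos (fst e)).
    replace ((b - a) * (Cnorm (fst e) * (snd e * exp (snd e)))) with
      (Cnorm (fst e) * 1 * ((b - a) * (snd e * exp (snd e)))) by ring.
    apply Rmult_le_compat_l; lra.
  - unfold ev; induction x as [|e x IH]; simpl; [ring|].
    rewrite IH by (intros e' He'; apply Hx; now right).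
    rewrite !Cexp_neg_polar; unfold Rminus.
    replace (ofR (exp (- a * snd e) + - exp (- b * snd e))) with
      (Csub (ofR (exp (- a * snd e))) (ofR (exp (- b * snd e))))
      by (apply Cplx_ext; simpl; ring).
    ring.
Qed.

(** The difference has coefficients multiplied by 1 - e^{c l}, and (e^{c l} - 1) e^{-(a + c) l} =
    e^{-a l} - e^{-(a + c) l} is small by [exp_neg_diff]. *)
Lemma Rep_shift_diff (P : R -> Prop) (x : list (Cplx * R)) (a c : R) :
  over P x -> (forall l, P l -> 0 <= l) -> 0 <= c -> -1 <= a ->
  Rep P (expw (a + c)) (fun s => Csub (ev x s) (ev x (shift c s)))
    (c * nrm (fun l => l * exp l) x).
Proof.
  intros Hx HP Hc Ha.
  exists (map (fun e => (Cmul (ofR (1 - exp (c * snd e))) (fst e), snd e)) x); repeat split.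
  - intros [sg t]; unfold ev, shift; simpl; rewrite Csum_map; simpl.
    induction x as [|e x IH]; simpl; [ring|].
    rewrite <- IH by (intros e' He'; apply Hx; now right).
    rewrite !Cexp_neg_polar.
    replace (- (sg - c) * snd e) with (c * snd e + - sg * snd e) by ring.
    rewrite exp_plus, ofR_mul.
    replace (ofR (1 - exp (c * snd e))) with (Csub C1 (ofR (exp (c * snd e))))
      by (apply Cplx_ext; simpl; ring).
    ring.
  - intros e He; apply in_map_iff in He; destruct He as [e' [<- He']]; simpl; auto.
  - unfold nrm; rewrite Rsum_map, <- Rsum_mul; simpl.
    apply Rsum_le; intros e He; unfold expw.
    assert (Hl : 0 <= snd e) by auto.
    assert (Hac : -1 <= a <= a + c) by lra.
    assert (H := exp_neg_diff a (a + c) (snd e) Hac Hl).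
    rewrite Cnorm_mul, Cnorm_ofR, Rabs_minus_sym, Rabs_right.
    + replace (_ * _ * _) with
        (Cnorm (fst e) * (exp (c * snd e) * exp (- (a + c) * snd e) - exp (- (a + c) * snd e)))
        by ring.
      rewrite <- exp_plus.
      replace (c * snd e + - (a + c) * snd e) with (- a * snd e) by ring.
      replace (c * (_ * _)) with (Cnorm (fst e) * ((a + c - a) * (snd e * exp (snd e)))) by ring.
      apply Rmult_le_compat_l; [apply Cnorm_pos|lra].
    + assert (H1 := exp_ineq1_le (c * snd e)); assert (0 <= c * snd e) by nra; lra.
Qed.

Lemma Rep_minus_constant_term (P : R -> Prop) (x : list (Cplx * R)) (eps : R) :
  P 0 -> (forall a b, P a -> P b -> P (a + b)) -> (forall l, P l -> 0 <= l) ->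
  over P x -> 0 < eps ->
  exists s0, forall sg, s0 <= sg ->
    Rep P (expw sg) (fun s => Csub (ev x s) (coef x 0)) eps.
Proof.
  intros H0 Ha HP; revert eps; induction x as [|[c m] x IH]; intros eps Hx Heps.
  { exists 0; intros sg _; apply Rep_le with (Cnorm C0); [rewrite Cnorm_C0; lra|].
    eapply Rep_ext; [|apply (Rep_const P _ (expw_monoid P sg H0 Ha))].
    intro s; unfold ev, coef; simpl; ring. }
  destruct (IH (eps / 2)) as [s0 Hs0]; [intros e He; apply Hx; now right|lra|].
  assert (Hm : P m) by exact (Hx _ (or_introl eq_refl)).
  destruct (Req_EM_T m 0) as [->|Hm0].
  - exists s0; intros sg Hsg; apply Rep_le with (eps / 2); [lra|].
    eapply Rep_ext; [|exact (Hs0 sg Hsg)].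
    intro s; unfold ev, coef; simpl; fold (ev x s); fold (coef x 0).
    destruct (Req_EM_T 0 0) as [_|]; [|congruence].
    rewrite Cexp_neg_0; ring.
  - assert (Hmp : 0 < m) by (specialize (HP m Hm); lra).
    (* By e^x >= 1 + x, this abscissa makes |c| e^{-sg m} at most eps/2. *)
    exists (Rmax s0 (2 * Cnorm c / (m * eps))); intros sg Hsg.
    assert (H1 := Rle_trans _ _ _ (Rmax_l _ _) Hsg).
    assert (H2 := Rle_trans _ _ _ (Rmax_r _ _) Hsg).
    apply Rep_le with (eps / 2 + eps / 2); [lra|].
    assert (Hc : Rep P (expw sg) (fun s => Cmul c (Cexp_neg m s)) (eps / 2)).
    { exists ((c, m) :: nil); repeat split.
      - intro s; unfold ev; simpl; ring.
      - intros e [<-|[]]; trivial.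
      - unfold nrm, expw; simpl; rewrite Rplus_0_r.
        replace (- sg * m) with (- (sg * m)) by ring; rewrite exp_Ropp.
        assert (H3 := exp_ineq1_le (sg * m)).
        assert (H4 : 2 * Cnorm c <= sg * m * eps).
        { replace (2 * Cnorm c) with (2 * Cnorm c / (m * eps) * (m * eps))
            by (field; lra).
          replace (sg * m * eps) with (sg * (m * eps)) by ring.
          apply Rmult_le_compat_r; [nra|trivial]. }
        apply Rmult_le_reg_r with (exp (sg * m)); [apply exp_pos|].
        rewrite Rmult_assoc, Rinv_l by apply Rgt_not_eq, exp_pos; nra. }
    eapply Rep_ext; [|exact (Rep_add P _ _ _ _ _ Hc (Hs0 sg H1))].
    intro s; unfold ev, coef; simpl; fold (ev x s); fold (coef x 0).
    destruct (Req_EM_T m 0) as [|_]; [contradiction|ring].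
Qed.

(** Far to the right all but the constant term has norm at most D/4, so the constant term has
    modulus at least 3D/4, and its inverse leaves an error of at most 1/3. *)
Lemma approx_invertible_right (P : R -> Prop) (x : list (Cplx * R)) (D : R) :
  P 0 -> (forall a b, P a -> P b -> P (a + b)) -> (forall l, P l -> 0 <= l) ->
  over P x -> 0 < D -> (forall sg, 0 < sg -> D <= Cnorm (ev x (sg, 0))) ->
  exists s0, 0 <= s0 /\ approx_invertible P s0 (ev x).
Proof.
  intros H0 Ha HP Hx HD Hlow.
  destruct (Rep_minus_constant_term P x (D / 4) H0 Ha HP Hx) as [s0 Hs0]; [lra|].
  set (sg := Rmax s0 1).
  assert (Hsg : 1 <= sg) by apply Rmax_r.
  specialize (Hs0 sg (Rmax_l _ _)).
  assert (HM := expw_monoid P sg H0 Ha).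
  assert (Hc : 3 * D / 4 <= Cnorm (coef x 0)).
  { assert (H1 := Rep_line P sg _ _ 0 Hs0); cbv beta in H1.
    assert (H2 := Hlow sg ltac:(lra)).
    assert (H3 := Cnorm_sub_ge (ev x (sg, 0)) (coef x 0)); lra. }
  destruct (Cinv_exists (coef x 0)) as [q Hq].
  { intro H; rewrite H, Cnorm_C0 in Hc; lra. }
  assert (HqN : Cnorm (coef x 0) * Cnorm q = 1)
    by now rewrite <- Cnorm_mul, Hq, Cnorm_C1.
  exists sg; split; [lra|].
  exists (fun _ => q), (Cnorm q), (D / 4 * Cnorm q); repeat split.
  - assert (H := Cnorm_pos q); nra.
  - now apply Rep_const.
  - eapply Rep_ext; [|exact (Rep_mul P _ HM _ _ _ _ (Rep_opp P _ _ _ Hs0) (Rep_const P _ HM q))].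
    intro s; cbv beta; rewrite <- Hq; ring.
Qed.

Lemma expw_Gen_summable (L : list R) (ta : R) :
  (forall l, In l L -> 0 < l) -> 0 < ta ->
  exists C, forall F, NoDup F -> (forall l, In l F -> Gen L l) -> Rsum (expw ta) F <= C.
Proof.
  intros HL Hta; apply (Gen_summable (Gen L)).
  - apply expw_monoid; [apply Gen_0|apply Gen_add].
  - apply Gen_in.
  - intros l Hl; exists 1, (exp (- ta * l)); repeat split.
    + apply Rlt_le, exp_pos.
    + rewrite <- exp_0; apply exp_increasing; specialize (HL l Hl); nra.
    + intro k; unfold expw; right; rewrite Rmult_1_l.
      induction k as [|k IH]; [simpl; rewrite Rmult_0_l, Rmult_0_r; apply exp_0|].
      rewrite S_INR; simpl; rewrite <- IH, <- exp_plus; f_equal; ring.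
Qed.

(* Moving the line of convergence to the left: the invertibility at [sg] gives bounds for the
   powers of the inverse at [sg + ta], which absorb the perturbation from [p] to
   [p (. - 2 ta)], i.e. an inverse at [sg - ta]. *)
Lemma approx_invertible_step (L : list R) (x : list (Cplx * R)) (D sg ta : R) :
  (forall l, In l L -> 0 < l) -> over (Gen L) x ->
  0 < D -> 0 < ta -> -1 <= sg - ta -> 2 * ta * nrm (fun l => l * exp l) x <= D / 4 ->
  (forall t, D <= Cnorm (ev x (sg, t))) ->
  approx_invertible (Gen L) sg (ev x) -> approx_invertible (Gen L) (sg - ta) (ev x).
Proof.
  intros HL Hx HD Hta Hsg Hd Hlow Hinv.
  assert (Hpos : forall l, Gen L l -> 0 <= l).
  { intros l; apply (Gen_sub (fun l => 0 <= l)); [lra|intros; lra|].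
    intros m Hm; apply Rlt_le; auto. }
  destruct (expw_Gen_summable L ta HL Hta) as [C HC].
  assert (HM : forall a, weighted_monoid (Gen L) (expw a))
    by (intro; apply expw_monoid; [apply Gen_0|apply Gen_add]).
  (* The weight at sg + ta, written in the form that [Rep_shift_diff] produces; relative to the
     weight at [sg] it is e^{-ta l}, summable over [Gen L]. *)
  destruct (change_of_weight (Gen L) (Gen L) (expw (sg - ta + 2 * ta)) sg C D (ev x))
    with (d := fun s => Csub (ev x s) (ev x (shift (2 * ta) s))) as [G [HG1 HG2]]; auto.
  - intros F HF HFL; apply Rle_trans with (2 := HC F HF HFL); right.
    apply Rsum_ext; intros l _; unfold expw; rewrite <- exp_plus; f_equal; ring.
  - apply Rep_le with (2 * ta * nrm (fun l => l * exp l) x); trivial.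
    apply Rep_shift_diff; trivial; lra.
  - exists (fun s => G (shift (- (2 * ta)) s)), (4 * C / D), (/ 2).
    replace (sg - ta) with (sg - ta + 2 * ta + - (2 * ta)) by ring.
    repeat split; [lra|now apply Rep_shift|].
    eapply Rep_ext; [|exact (Rep_shift _ _ _ _ _ HG2)].
    intros [a t]; cbv beta.
    replace (shift (2 * ta) (shift (- (2 * ta)) (a, t))) with ((a, t) : Cplx)
      by (unfold shift; simpl; f_equal; ring).
    ring.
Qed.

(** The admissible step length depends only on [D] and on the Lipschitz constant, the same at every
    abscissa, so finitely many equal steps lead from s0 to -et. *)
Lemma approx_invertible_left (L : list R) (x : list (Cplx * R)) (D et : R) :
  (forall l, In l L -> 0 < l) -> over (Gen L) x -> 0 < D -> 0 < et <= / 2 ->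
  (forall sg t, - et <= sg -> D <= Cnorm (ev x (sg, t))) ->
  approx_invertible (Gen L) (- et) (ev x).
Proof.
  intros HL Hx HD Het Hlow.
  assert (Hpos : forall l, Gen L l -> 0 <= l).
  { intros l; apply (Gen_sub (fun l => 0 <= l)); [lra|intros; lra|].
    intros m Hm; apply Rlt_le; auto. }
  destruct (approx_invertible_right (Gen L) x D) as [s0 [Hs0 Hinv]]; trivial.
  { apply Gen_0. } { apply Gen_add. } { intros; apply Hlow; lra. }
  set (K := nrm (fun l => l * exp l) x).
  assert (HK : 0 <= K).
  { apply Rsum_nonneg; intros e He; apply Rmult_le_pos; [apply Cnorm_pos|].
    apply Rmult_le_pos; [auto|apply Rlt_le, exp_pos]. }
  (* A step [ta] needs 2 ta K <= D/4, that is ta (8 K / D) <= 1. The summand 2 keeps [N] positive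
     even when K = 0. *)
  destruct (INR_unbounded ((s0 + et) * (2 + 8 * K / D))) as [N HN].
  assert (HKD : 0 <= 8 * K / D) by (apply Rdiv_le_0_compat; lra).
  assert (HN0 : 0 < INR N) by nra.
  set (ta := (s0 + et) / INR N).
  assert (Hta : 0 < ta) by (apply Rdiv_lt_0_compat; lra).
  assert (HtaN : ta * INR N = s0 + et) by (unfold ta; field; lra).
  assert (Hta1 : ta * (2 + 8 * K / D) < 1).
  { apply Rmult_lt_reg_r with (INR N); trivial.
    replace (ta * _ * INR N) with (ta * INR N * (2 + 8 * K / D)) by ring.
    rewrite HtaN; lra. }
  assert (Hall : forall k, (k <= N)%nat ->
            approx_invertible (Gen L) (s0 - INR k * ta) (ev x)).
  { induction k as [|k IH]; intro Hk.
    - simpl; now replace (s0 - 0 * ta) with s0 by ring.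
    - assert (HkN : INR k + 1 <= INR N) by (rewrite <- S_INR; now apply le_INR).
      assert (Hge : - et <= s0 - INR k * ta - ta) by nra.
      rewrite S_INR; replace (s0 - _) with (s0 - INR k * ta - ta) by ring.
      apply (approx_invertible_step L x D); trivial; try lra.
      + assert (ta * (8 * K / D) <= 1) by nra.
        replace (2 * ta * _) with (ta * (8 * K / D) * (D / 4)) by (unfold K; field; lra).
        rewrite <- (Rmult_1_l (D / 4)) at 2; apply Rmult_le_compat_r; lra.
      + intro t; apply Hlow; lra.
      + apply IH; lia. }
  replace (- et) with (s0 - INR N * ta) by (rewrite Rmult_comm, HtaN; ring).
  now apply Hall.
Qed.

(** * Unordered sums *)

Definition rate (k : nat) : R := / (INR k + 1).

Lemma rate_pos (k : nat) : 0 < rate k.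
Proof. apply Rinv_0_lt_compat; assert (H := pos_INR k); lra. Qed.

Lemma rate_small (c eps : R) : 0 < eps -> exists N, forall k, (N <= k)%nat -> c * rate k <= eps.
Proof.
  intro He; destruct (INR_unbounded (c / eps)) as [N HN].
  exists N; intros k Hk; apply le_INR in Hk; assert (Hr := rate_pos k).
  assert (H := pos_INR k).
  apply Rmult_le_reg_r with (INR k + 1); [lra|].
  unfold rate; rewrite Rmult_assoc, Rinv_l, Rmult_1_r by lra.
  replace c with (c / eps * eps) by (field; lra); nra.
Qed.

(** Letting [m] tend to infinity in the Cauchy estimate keeps an explicit rate for the limit. *)
Lemma complete_rate (x : nat -> Cplx) (E : R) :
  (forall n m, Cnorm (Csub (x n) (x m)) <= E * (rate n + rate m)) ->
  exists z, forall n, Cnorm (Csub (x n) z) <= E * rate n.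
Proof.
  intro H.
  assert (HR : forall g : Cplx -> R,
      (forall z u, Rabs (g z - g u) <= Cnorm (Csub z u)) -> exists l, Un_cv (fun n => g (x n)) l).
  { intros g Hg;
    destruct (Rcomplete.R_complete (fun n => g (x n))) as [l Hl]; [|now exists l].
    intros eps Heps; destruct (rate_small E (eps / 3)) as [N HN]; [lra|].
    exists N; intros n m Hn Hm; unfold Rdist.
    apply Rle_lt_trans with (1 := Hg _ _), Rle_lt_trans with (1 := H n m).
    assert (H1 := HN n Hn); assert (H2 := HN m Hm); lra. }
  destruct (HR fst) as [l1 H1].
  { intros z u; exact (Cnorm_fst (Csub z u)). }
  destruct (HR snd) as [l2 H2].
  { intros z u; exact (Cnorm_snd (Csub z u)). }
  exists (l1, l2); intro n; apply Rle_plus_epsilon; intros eps Heps.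
  destruct (H1 (eps / 3)) as [N1 HN1]; [lra|].
  destruct (H2 (eps / 3)) as [N2 HN2]; [lra|].
  destruct (rate_small E (eps / 3)) as [N3 HN3]; [lra|].
  set (m := Nat.max N1 (Nat.max N2 N3)).
  specialize (HN1 m ltac:(lia)); specialize (HN2 m ltac:(lia)); specialize (HN3 m ltac:(lia)).
  unfold Rdist in HN1, HN2.
  replace (Csub (x n) (l1, l2)) with (Cadd (Csub (x n) (x m)) (Csub (x m) (l1, l2))) by ring.
  eapply Rle_trans; [apply Cnorm_add|].
  assert (H3 := Cnorm_le_abs (Csub (x m) (l1, l2))); simpl in H3.
  specialize (H n m); lra.
Qed.

Definition eq_dec_cl {I : Type} (x y : I) : {x = y} + {x <> y} :=
  excluded_middle_informative (x = y).

Definition tail_le {I : Type} (P : I -> Prop) (g : I -> R) (F0 : list I) (rho : R) : Prop :=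
  forall F, fin_sub P F -> (forall i, In i F -> ~ In i F0) -> Rsum g F <= rho.

Section Unordered.
Context {I : Type} (P : I -> Prop).

Lemma fin_sub_union (F G : list I) : fin_sub P F -> fin_sub P G ->
  exists U, fin_sub P U /\ incl F U /\ incl G U.
Proof.
  intros [_ HF] [_ HG]; exists (nodup eq_dec_cl (F ++ G)); repeat split.
  - apply NoDup_nodup.
  - apply Forall_forall; intros i Hi; apply nodup_In, in_app_or in Hi.
    rewrite Forall_forall in HF, HG; destruct Hi; auto.
  - intros i Hi; apply nodup_In, in_or_app; auto.
  - intros i Hi; apply nodup_In, in_or_app; auto.
Qed.

Lemma fin_sub_in (F : list I) (i : I) : fin_sub P F -> In i F -> P i.
Proof. intros [_ H]; rewrite Forall_forall in H; auto. Qed.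

Lemma fin_sub_extend (F G : list I) : fin_sub P F -> fin_sub P G -> incl F G ->
  exists D, Permutation G (F ++ D) /\ fin_sub P D /\ forall i, In i D -> ~ In i F.
Proof.
  intros [HF _] [HG HGP] Hincl; destruct (incl_Permutation_app F G HF Hincl) as [D HD].
  exists D; split; trivial; apply (Permutation_NoDup HD) in HG; repeat split.
  - now apply NoDup_app_remove_l in HG.
  - apply (Permutation_Forall HD), Forall_app in HGP; tauto.
  - intros i Hi HiF; destruct (in_split i F HiF) as [F1 [F2 ->]].
    rewrite <- app_assoc in HG; simpl in HG; apply NoDup_remove_2 in HG; apply HG.
    rewrite !in_app_iff; auto.
Qed.

Variable g : I -> R.
Hypothesis Hg : finite_sum_nonneg P g.

(** A finite sum within [rho] of the supremum leaves at most [rho] for any disjoint finite set. *)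
Lemma small_tail (rho : R) : 0 < rho -> exists F0, fin_sub P F0 /\ tail_le P g F0 rho.
Proof.
  intro Hrho.
  destruct (completeness (fun r => exists F, fin_sub P F /\ r = Rsum g F)) as [S [HS1 HS2]].
  { destruct Hg as [M HM]; exists M; intros r [F [HF ->]]; auto. }
  { exists 0, nil; repeat split; constructor. }
  destruct (classic (exists F0, fin_sub P F0 /\ S - rho < Rsum g F0)) as [[F0 [HF0 HS]]|Hno].
  - exists F0; split; trivial; intros F HF Hdisj.
    assert (H : Rsum g (F0 ++ F) <= S).
    { apply HS1; exists (F0 ++ F); repeat split.
      - apply NoDup_app; [apply HF0|apply HF|intros i H1 H2; exact (Hdisj i H2 H1)].
      - apply Forall_app; split; [apply HF0|apply HF]. }
    rewrite Rsum_app in H; lra.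
  - assert (H : S <= S - rho); [|lra].
    apply HS2; intros r [F [HF ->]]; apply Rnot_lt_le; intro H; apply Hno; eauto.
Qed.

Lemma tail_le_mono (F0 F1 : list I) (rho : R) :
  incl F0 F1 -> tail_le P g F0 rho -> tail_le P g F1 rho.
Proof. intros Hi HF0 F HF Hd; apply HF0; trivial; intros i H1 H2; exact (Hd i H1 (Hi i H2)). Qed.

Lemma small_tail_above (F1 : list I) (rho : R) : fin_sub P F1 -> 0 < rho ->
  exists F0, fin_sub P F0 /\ incl F1 F0 /\ tail_le P g F0 rho.
Proof.
  intros HF1 Hrho; destruct (small_tail rho Hrho) as [F0 [HF0 Ht]].
  destruct (fin_sub_union F0 F1 HF0 HF1) as [U [HU [H0 H1]]].
  exists U; repeat split; try apply HU; trivial; now apply tail_le_mono with F0.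
Qed.

Variable f : I -> Cplx.
Hypothesis Hf : forall i, P i -> Cnorm (f i) <= g i.

Lemma Csum_tail (F0 F : list I) (rho : R) :
  fin_sub P F0 -> tail_le P g F0 rho -> fin_sub P F -> incl F0 F ->
  Cnorm (Csub (Csum f F) (Csum f F0)) <= rho.
Proof.
  intros HF0 Ht HF Hi; destruct (fin_sub_extend F0 F HF0 HF Hi) as [D [HD [HDP Hd]]].
  rewrite (Csum_Permutation f _ _ HD), Csum_app.
  replace (Csub _ _) with (Csum f D) by ring.
  apply Rle_trans with (2 := Ht D HDP Hd), Rle_trans with (1 := Cnorm_Csum f D).
  apply Rsum_le; intros i HiD; apply Hf, (fin_sub_in D); trivial.
Qed.

Lemma has_sum_tail (F0 : list I) (rho : R) (z : Cplx) :
  fin_sub P F0 -> tail_le P g F0 rho -> has_sum P f z ->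
  Cnorm (Csub (Csum f F0) z) <= rho.
Proof.
  intros HF0 Ht Hz; apply Rle_plus_epsilon; intros eps Heps.
  destruct (Hz eps Heps) as [F1 [HF1 H1]].
  destruct (fin_sub_union F0 F1 HF0 HF1) as [U [HU [H0U H1U]]].
  specialize (H1 U HU H1U).
  assert (H2 := Csum_tail F0 U rho HF0 Ht HU H0U).
  rewrite Cnorm_sub_sym in H2.
  replace (Csub _ _) with (Cadd (Csub (Csum f F0) (Csum f U)) (Csub (Csum f U) z)) by ring.
  eapply Rle_trans; [apply Cnorm_add|lra].
Qed.

Lemma has_sum_exists : exists z, has_sum P f z.
Proof.
  destruct (choice (fun k F => fin_sub P F /\ tail_le P g F (rate k))) as [F HF].
  { intro k; apply small_tail, rate_pos. }
  destruct (complete_rate (fun k => Csum f (F k)) 1) as [z Hz].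
  { intros n m; destruct (HF n) as [Hn Tn], (HF m) as [Hm Tm].
    destruct (fin_sub_union (F n) (F m) Hn Hm) as [U [HU [HnU HmU]]].
    assert (H1 := Csum_tail _ _ _ Hn Tn HU HnU).
    assert (H2 := Csum_tail _ _ _ Hm Tm HU HmU).
    rewrite Cnorm_sub_sym in H1.
    replace (Csub _ _) with
      (Cadd (Csub (Csum f (F n)) (Csum f U)) (Csub (Csum f U) (Csum f (F m)))) by ring.
    eapply Rle_trans; [apply Cnorm_add|lra]. }
  exists z; intros eps Heps; destruct (rate_small 2 (eps / 2)) as [N HN]; [lra|].
  specialize (HN N (le_n N)); destruct (HF N) as [H1 H2].
  exists (F N); split; trivial; intros G HG Hi.
  assert (H3 := Csum_tail _ _ _ H1 H2 HG Hi); specialize (Hz N).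
  replace (Csub _ _) with
    (Cadd (Csub (Csum f G) (Csum f (F N))) (Csub (Csum f (F N)) z)) by ring.
  apply Rle_lt_trans with (1 := Cnorm_add _ _); lra.
Qed.

End Unordered.

Definition off {I : Type} (F0 : list I) (g : I -> R) (i : I) : R :=
  if excluded_middle_informative (In i F0) then 0 else g i.

(** Makes the tail bound usable on finite sets that meet [F0]. *)
Lemma Rsum_off {I : Type} (P : I -> Prop) (g : I -> R) (F0 F : list I) (rho : R) :
  tail_le P g F0 rho -> fin_sub P F -> Rsum (off F0 g) F <= rho.
Proof.
  intros Ht HF.
  set (d := fun i => if excluded_middle_informative (In i F0) then false else true).
  replace (Rsum (off F0 g) F) with (Rsum g (filter d F)).
  - apply Ht.
    + split; [apply NoDup_filter, HF|].
      apply Forall_forall; intros i Hi; apply filter_In in Hi.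
      now apply (fin_sub_in P F).
    + intros i Hi; apply filter_In in Hi; unfold d in Hi.
      destruct excluded_middle_informative; [destruct Hi; discriminate|trivial].
  - clear; induction F as [|i F IH]; simpl; trivial.
    unfold off at 1, d at 1; destruct excluded_middle_informative; simpl; rewrite IH; ring.
Qed.

Lemma NoDup_list_prod {I J : Type} (F : list I) (G : list J) :
  NoDup F -> NoDup G -> NoDup (list_prod F G).
Proof.
  intros HF HG; induction HF as [|i F Hi HF IH]; simpl; [constructor|].
  apply NoDup_app; trivial.
  - apply Injective_map_NoDup; trivial; intros x y Hxy; congruence.
  - intros p Hp Hq; apply in_map_iff in Hp; destruct Hp as [y [<- _]].
    apply in_prod_iff in Hq; tauto.
Qed.

Lemma NoDup_flat_map_fibers {I J : Type} (h : J -> I) (U : I -> list J) (L : list I) :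
  NoDup L -> (forall i, NoDup (U i)) -> (forall i j, In j (U i) -> h j = i) ->
  NoDup (flat_map U L).
Proof.
  intros HL HU Hh; induction HL as [|i L Hi HL IH]; simpl; [constructor|].
  apply NoDup_app; trivial.
  intros j H1 H2; apply in_flat_map in H2; destruct H2 as [i' [Hi' H2]].
  apply Hh in H1; apply Hh in H2; congruence.
Qed.

(** [D] lies in the product of its two projections, over which the sum factors. *)
Lemma Rsum_pairs_le {I J : Type} (g : I -> R) (h : J -> R) (D : list (I * J)) (A B : R) :
  NoDup D -> (forall i, In i (map fst D) -> 0 <= g i) -> (forall j, In j (map snd D) -> 0 <= h j) ->
  (forall X, NoDup X -> incl X (map fst D) -> Rsum g X <= A) ->
  (forall Y, NoDup Y -> incl Y (map snd D) -> Rsum h Y <= B) ->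
  Rsum (fun p => g (fst p) * h (snd p)) D <= A * B.
Proof.
  intros HD Hg Hh HA HB.
  set (X := nodup eq_dec_cl (map fst D)); set (Y := nodup eq_dec_cl (map snd D)).
  assert (HX : incl X (map fst D)) by (intros i Hi; now apply nodup_In in Hi).
  assert (HY : incl Y (map snd D)) by (intros i Hi; now apply nodup_In in Hi).
  apply Rle_trans with (Rsum g X * Rsum h Y).
  - rewrite <- Rsum_list_prod; apply Rsum_incl; trivial.
    + intros [i j] Hp; apply in_prod_iff; split; apply nodup_In.
      * now apply (in_map fst) in Hp.
      * now apply (in_map snd) in Hp.
    + intros [i j] Hp; apply in_prod_iff in Hp; apply Rmult_le_pos; [apply Hg|apply Hh];
        [apply HX|apply HY]; tauto.
  - apply Rmult_le_compat; auto using NoDup_nodup.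
    + apply Rsum_nonneg; auto.
    + apply Rsum_nonneg; auto.
    + apply HA; [apply NoDup_nodup|trivial].
    + apply HB; [apply NoDup_nodup|trivial].
Qed.

(** * Inversion in the weighted algebra *)

(** Since w(k l)^{1/k} tends to 1, eventually w(k l) <= e^{k et l / 2}; this uses up half of the
    exponential decay, and the other half is r^k. The finitely many remaining k are absorbed in
    D. *)
Lemma admissible_growth (Lam : R -> Prop) (w : R -> R) (et l : R) :
  semigroup0 Lam -> admissible Lam w -> 0 < et -> Lam l -> 0 < l ->
  exists D r, 0 <= r < 1 /\ forall k, w (INR k * l) * exp (- et * (INR k * l)) <= D * r ^ k.
Proof.
  intros [HL0 [HLp HLa]] [_ [Hw1 Hlim]] Het Hl Hlp.
  set (r := exp (- (et * l / 2))).
  assert (Hx : 0 < et * l) by now apply Rmult_lt_0_compat.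
  assert (Hr : 0 < r < 1).
  { split; [apply exp_pos|]; unfold r; rewrite <- exp_0; apply exp_increasing; lra. }
  assert (Hexp : forall x k, exp (INR k * x) = exp x ^ k).
  { intros x k; induction k as [|k IH]; [simpl; rewrite Rmult_0_l; apply exp_0|].
    rewrite S_INR; simpl; rewrite <- IH, <- exp_plus; f_equal; ring. }
  assert (Hev : exists N, forall k, (N <= k)%nat ->
            w (INR k * l) * exp (- et * (INR k * l)) <= r ^ k).
  { destruct (Hlim l Hl (exp (et * l / 2) - 1)) as [N HN].
    { assert (H := exp_ineq1_le (et * l / 2)); lra. }
    (* Term k of the sequence in [admissible] belongs to the multiple S k, hence the shift. *)
    exists (S N); intros [|k] Hk; [lia|].
    specialize (HN k ltac:(lia)); unfold Rdist in HN; apply Rabs_def2 in HN.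
    assert (HkP : 0 < INR (S k)) by (apply lt_0_INR; lia).
    assert (Hw : 1 <= w (INR (S k) * l)) by (apply Hw1, monoid_mult; trivial).
    assert (Hle : w (INR (S k) * l) <= exp (et * l / 2) ^ S k).
    { replace (w (INR (S k) * l)) with
        (Rpower (w (INR (S k) * l)) (/ INR (S k)) ^ S k).
      - apply pow_incr; split; [apply Rlt_le, exp_pos|lra].
      - rewrite <- Rpower_pow by apply exp_pos.
        rewrite Rpower_mult, Rinv_l by lra; apply Rpower_1; lra. }
    replace (- et * (INR (S k) * l)) with (INR (S k) * (- (et * l))) by ring.
    rewrite Hexp.
    apply Rle_trans with (exp (et * l / 2) ^ S k * exp (- (et * l)) ^ S k).
    - apply Rmult_le_compat_r; [apply pow_le, Rlt_le, exp_pos|trivial].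
    - rewrite <- Rpow_mult_distr, <- exp_plus; right; unfold r; do 2 f_equal; field. }
  destruct Hev as [N HN].
  set (f := fun k => w (INR k * l) * exp (- et * (INR k * l))).
  assert (HD : forall M, exists D, 1 <= D /\ forall k, (k < M)%nat -> f k <= D * r ^ k).
  { induction M as [|M [D [HD1 HD]]]; [exists 1; split; [lra|lia]|].
    assert (HrM : 0 < r ^ M) by now apply pow_lt.
    exists (Rmax D (f M / r ^ M)); split; [apply Rle_trans with (2 := Rmax_l _ _); lra|].
    intros k Hk; destruct (Nat.eq_dec k M) as [->|Hne].
    - apply Rle_trans with (f M / r ^ M * r ^ M); [right; field; lra|].
      apply Rmult_le_compat_r; [lra|apply Rmax_r].
    - apply Rle_trans with (1 := HD k ltac:(lia)).
      apply Rmult_le_compat_r; [apply pow_le; lra|apply Rmax_l]. }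
  destruct (HD N) as [D [HD1 HD2]]; exists D, r; split; [lra|]; intro k.
  destruct (Nat.lt_ge_cases k N) as [Hk|Hk]; [now apply HD2|].
  apply Rle_trans with (1 := HN k Hk).
  rewrite <- (Rmult_1_l (r ^ k)) at 1; apply Rmult_le_compat_r; [apply pow_le|]; lra.
Qed.

Lemma admissible_monoid (Lam : R -> Prop) (w : R -> R) :
  semigroup0 Lam -> admissible Lam w -> weighted_monoid Lam w.
Proof.
  intros [HL0 [_ HLa]] [[Hpos [H0 Hm]] _]; repeat split; trivial.
  intros l Hl; apply Rlt_le; auto.
Qed.

Lemma weighted_monoid_mul (P : R -> Prop) (u v : R -> R) :
  weighted_monoid P u -> weighted_monoid P v -> weighted_monoid P (fun l => u l * v l).
Proof.
  intros [H0 [Ha [Hu [Hu0 Hum]]]] [_ [_ [Hv [Hv0 Hvm]]]]; repeat split; trivial.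
  - intros l Hl; apply Rmult_le_pos; auto.
  - rewrite Hu0, Hv0; ring.
  - intros l m Hl Hm.
    replace (u l * v l * (u m * v m)) with ((u l * u m) * (v l * v m)) by ring.
    apply Rmult_le_compat; auto.
Qed.

Section Wiener.
Variables (Lam : R -> Prop) (w : R -> R).
Hypotheses (HLam : semigroup0 Lam) (Hw : admissible Lam w).
Variable a : R -> Cplx.
Hypothesis Ha : in_Aw Lam w a.

Let Hmon : weighted_monoid Lam w.
Proof. now apply admissible_monoid. Qed.

Let Hw1 : forall l, Lam l -> 1 <= w l.
Proof. apply Hw. Qed.

Let HLpos : forall l, Lam l -> 0 <= l.
Proof. apply HLam. Qed.

Let exp_le_1 (s : Cplx) (l : R) : 0 <= fst s -> Lam l -> Cnorm (Cexp_neg l s) <= 1.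
Proof.
  intros Hs Hl; rewrite Cnorm_Cexp_neg, <- exp_0.
  destruct (Req_dec (- fst s * l) 0) as [->|Hne]; [lra|].
  apply Rlt_le, exp_increasing; specialize (HLpos l Hl); nra.
Qed.

Let term_le_coef (b : R -> Cplx) (s : Cplx) (l : R) :
  0 <= fst s -> Lam l -> Cnorm (Cmul (b l) (Cexp_neg l s)) <= Cnorm (b l).
Proof.
  intros Hs Hl; rewrite Cnorm_mul, <- Rmult_1_r.
  apply Rmult_le_compat_l; [apply Cnorm_pos|auto].
Qed.

Let term_le (b : R -> Cplx) (s : Cplx) (l : R) :
  0 <= fst s -> Lam l -> Cnorm (Cmul (b l) (Cexp_neg l s)) <= Cnorm (b l) * w l.
Proof.
  intros Hs Hl; rewrite Cnorm_mul; apply Rmult_le_compat_l; [apply Cnorm_pos|].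
  apply Rle_trans with 1; auto.
Qed.

Let norm_le (b : R -> Cplx) (l : R) : Lam l -> Cnorm (b l) <= Cnorm (b l) * w l.
Proof. intro Hl; assert (H := Hw1 l Hl); assert (H0 := Cnorm_pos (b l)); nra. Qed.

Let summable_bound (b : R -> Cplx) : in_Aw Lam w b ->
  exists M, 0 <= M /\ forall F, NoDup F -> (forall l, In l F -> Lam l) ->
    Rsum (fun l => Cnorm (b l)) F <= M.
Proof.
  intros [M HM]; exists M; split; [apply (HM nil); split; constructor|].
  intros F HF HFL; apply Rle_trans with (Rsum (fun l => Cnorm (b l) * w l) F).
  - apply Rsum_le; intros l Hl; auto.
  - apply HM; split; [trivial|now apply Forall_forall].
Qed.

(** * Invertible elements have transforms bounded away from 0 *)

(** A pair outside the rectangle [Fa] x [Fb] has its first coordinate off [Fa] or its second off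
    [Fb]: a tail of one factor times the full norm of the other. *)
Lemma product_of_tails_le (b : R -> Cplx) (Fa Fb : list R) (D : list (R * R)) (A B ra rb : R) :
  (forall F, NoDup F -> (forall l, In l F -> Lam l) -> Rsum (fun l => Cnorm (a l)) F <= A) ->
  (forall F, NoDup F -> (forall l, In l F -> Lam l) -> Rsum (fun l => Cnorm (b l)) F <= B) ->
  tail_le Lam (fun l => Cnorm (a l)) Fa ra -> tail_le Lam (fun l => Cnorm (b l)) Fb rb ->
  NoDup D -> (forall p, In p D -> Lam (fst p) /\ Lam (snd p)) ->
  (forall p, In p D -> ~ In p (list_prod Fa Fb)) ->
  Rsum (fun p => Cnorm (a (fst p)) * Cnorm (b (snd p))) D <= ra * B + A * rb.
Proof.
  intros HA HB Hra Hrb HD HDL Hdis.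
  set (ga := fun l => Cnorm (a l)) in *; set (gb := fun l => Cnorm (b l)) in *.
  assert (Hoff : forall (F : list R) (g : R -> R) l, (forall l, 0 <= g l) -> 0 <= off F g l).
  { intros F g l Hg; unfold off; destruct excluded_middle_informative; [lra|trivial]. }
  assert (Hga : forall l, 0 <= ga l) by (intro; apply Cnorm_pos).
  assert (Hgb : forall l, 0 <= gb l) by (intro; apply Cnorm_pos).
  assert (HX : forall l, In l (map fst D) -> Lam l).
  { intros l Hl; apply in_map_iff in Hl; destruct Hl as [p [<- Hp]]; now apply HDL. }
  assert (HY : forall l, In l (map snd D) -> Lam l).
  { intros l Hl; apply in_map_iff in Hl; destruct Hl as [p [<- Hp]]; now apply HDL. }
  apply Rle_trans with
    (Rsum (fun p => off Fa ga (fst p) * gb (snd p) + ga (fst p) * off Fb gb (snd p)) D).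
  - apply Rsum_le; intros [l m] Hp; specialize (Hdis _ Hp); rewrite in_prod_iff in Hdis; simpl.
    assert (H1 := Hga l); assert (H2 := Hgb m); assert (H3 := Rmult_le_pos _ _ H1 H2).
    fold (ga l); fold (gb m).
    unfold off; destruct excluded_middle_informative, excluded_middle_informative;
      [tauto|lra|lra|lra].
  - rewrite Rsum_add; apply Rplus_le_compat; apply Rsum_pairs_le; auto.
    + intros X HXn HXi; apply (Rsum_off Lam); trivial.
      split; [trivial|apply Forall_forall; auto].
    + intros X HXn HXi; apply (Rsum_off Lam); trivial.
      split; [trivial|apply Forall_forall; auto].
Qed.

(** A finite form of a~ b~ = 1: a finite set [T] of pairs, on which the convolution sums nearly
    equal [delta0], contains a rectangle [Pd] on which the double sum factors. A small value z of a~
    then gives 1 <= (|z| + rho) B + (rho B + A rho) + rho < 1. *)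
Lemma invertible_not_closure :
  invertible_Aw Lam w a -> ~ closureC (tilde_image_H Lam a) C0.
Proof.
  intros [b [Hb Hconv]] Hcl.
  destruct (summable_bound a Ha) as [A [HA0 HA]].
  destruct (summable_bound b Hb) as [B [HB0 HB]].
  destruct (Hcl (/ (2 * (B + 1)))) as [z [[s [Hs Hz]] Hsmall]].
  { apply Rinv_0_lt_compat; lra. }
  replace (Csub z C0) with z in Hsmall by ring.
  assert (HzB : Cnorm z * B < / 2).
  { apply Rle_lt_trans with (Cnorm z * (B + 1)).
    - apply Rmult_le_compat_l; [apply Cnorm_pos|lra].
    - replace (/ 2) with (/ (2 * (B + 1)) * (B + 1)) by (field; lra).
      apply Rmult_lt_compat_r; lra. }
  (* 2 B + A + 1 counts the errors of size [rho]; together they make 1/2, and |z| B is below 1/2. *)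
  set (rho := / (2 * (2 * B + A + 1))).
  assert (Hrho : 0 < rho) by (apply Rinv_0_lt_compat; lra).
  assert (Hrho2 : rho * (2 * B + A + 1) = / 2) by (unfold rho; field; lra).
  unfold Re in Hs.
  destruct (small_tail Lam _ Ha rho Hrho) as [Fa [HFa Hta]].
  destruct (small_tail Lam _ Hb rho Hrho) as [Fb [HFb Htb]].
  set (fa := fun l => Cmul (a l) (Cexp_neg l s)).
  set (fb := fun l => Cmul (b l) (Cexp_neg l s)).
  assert (Hfa : forall l, Lam l -> Cnorm (fa l) <= Cnorm (a l))
    by (intros l Hl; apply term_le_coef; [lra|trivial]).
  assert (Hfb : forall l, Lam l -> Cnorm (fb l) <= Cnorm (b l))
    by (intros l Hl; apply term_le_coef; [lra|trivial]).
  set (Pd := list_prod Fa Fb).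
  set (plus := fun p : R * R => fst p + snd p).
  (* 0 is added because the rectangle may contain no pair with sum 0, while the whole of [delta0]
     must be seen. *)
  set (L := nodup Req_EM_T (0 :: map plus Pd)).
  assert (HL0 : In 0 L) by (apply nodup_In; now left).
  assert (HLL : forall l, In l L -> Lam l).
  { intros l Hl; apply nodup_In in Hl; destruct Hl as [<-|Hl]; [apply HLam|].
    apply in_map_iff in Hl; destruct Hl as [[m n] [<- Hp]]; apply in_prod_iff in Hp.
    apply HLam; [apply (fin_sub_in Lam Fa)|apply (fin_sub_in Lam Fb)]; tauto. }
  assert (HLlen : 0 < INR (length L)).
  { apply lt_0_INR; destruct L; [destruct HL0|simpl; lia]. }
  set (PP := fun l (p : R * R) => Lam (fst p) /\ Lam (snd p) /\ fst p + snd p = l).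
  set (ab := fun p : R * R => Cmul (a (fst p)) (b (snd p))).
  assert (HU : forall l, exists U, Lam l ->
      fin_sub (PP l) U /\ (forall p, In p Pd -> plus p = l -> In p U) /\
      Cnorm (Csub (Csum ab U) (delta0 l)) <= rho / INR (length L)).
  { intro l; destruct (classic (Lam l)) as [Hl|Hl]; [|exists nil; intro; contradiction].
    destruct (Hconv l Hl (rho / INR (length L))) as [F0 [HF0 H0]].
    { now apply Rdiv_lt_0_compat. }
    set (G := filter (fun p => if Req_EM_T (plus p) l then true else false) Pd).
    assert (HG : fin_sub (PP l) G).
    { split; [apply NoDup_filter, NoDup_list_prod; [apply HFa|apply HFb]|].
      apply Forall_forall; intros [m n] Hp; apply filter_In in Hp; destruct Hp as [Hp Hpl].
      apply in_prod_iff in Hp; unfold PP; simpl; repeat split.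
      - now apply (fin_sub_in Lam Fa).
      - now apply (fin_sub_in Lam Fb).
      - unfold plus in Hpl; simpl in Hpl; destruct Req_EM_T; [trivial|discriminate]. }
    destruct (fin_sub_union (PP l) F0 G HF0 HG) as [U [HU [H0U HGU]]].
    exists U; intros _; split; [trivial|split].
    - intros p Hp Hpl; apply HGU, filter_In; split; [trivial|].
      destruct Req_EM_T; [trivial|contradiction].
    - apply Rlt_le, H0; trivial. }
  apply choice in HU; destruct HU as [U0 HU0].
  (* [NoDup_flat_map_fibers] speaks of all indices, but [U0] is controlled on [Lam] only. *)
  set (U := fun l => if excluded_middle_informative (In l L) then U0 l else nil).
  assert (HU : forall l, In l L -> U l = U0 l).
  { intros l Hl; unfold U; destruct excluded_middle_informative; [trivial|contradiction]. }
  set (T := flat_map U L).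
  assert (HTL : forall p, In p T -> Lam (fst p) /\ Lam (snd p)).
  { intros p Hp; apply in_flat_map in Hp; destruct Hp as [l [Hl Hp]]; rewrite HU in Hp by trivial.
    destruct (HU0 l (HLL l Hl)) as [H _]; apply (fin_sub_in _ _ _ H) in Hp.
    unfold PP in Hp; tauto. }
  assert (HT : NoDup T).
  { apply (NoDup_flat_map_fibers plus); [apply NoDup_nodup| |].
    - intro l; unfold U; destruct excluded_middle_informative as [Hl|]; [|constructor].
      apply (HU0 l (HLL l Hl)).
    - intros l p; unfold U; destruct excluded_middle_informative as [Hl|]; [|intros []].
      intro Hp; destruct (HU0 l (HLL l Hl)) as [H _]; apply (fin_sub_in _ _ _ H) in Hp.
      apply Hp. }
  assert (HPd : fin_sub (fun p => In p T) Pd).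
  { split; [apply NoDup_list_prod; [apply HFa|apply HFb]|].
    apply Forall_forall; intros p Hp.
    assert (Hl : In (plus p) L) by (apply nodup_In; right; now apply in_map).
    apply in_flat_map; exists (plus p); split; trivial.
    rewrite HU by trivial; now apply (HU0 (plus p) (HLL _ Hl)). }
  destruct (fin_sub_extend (fun p => In p T) Pd T) as [D [HD [HDT Hdis]]]; trivial.
  { split; [trivial|now apply Forall_forall]. }
  { intros p Hp; exact (fin_sub_in _ Pd p HPd Hp). }
  set (h := fun p : R * R => Cmul (fa (fst p)) (fb (snd p))).
  assert (HhT : Csum h T = Csum (fun l => Cmul (Cexp_neg l s) (Csum ab (U l))) L).
  { unfold T; rewrite Csum_flat_map; apply Csum_ext; intros l Hl.
    rewrite <- Csum_mul; apply Csum_ext; intros p Hp; rewrite HU in Hp by trivial.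
    destruct (HU0 l (HLL l Hl)) as [H _]; apply (fin_sub_in _ _ _ H) in Hp.
    destruct Hp as [_ [_ <-]]; unfold h, ab, fa, fb; rewrite Cexp_neg_add; ring. }
  assert (H1 : Cnorm (Csub (Csum h T) C1) <= rho).
  { replace C1 with (Csum (fun l => Cmul (if Req_EM_T 0 l then C1 else C0) (Cexp_neg l s)) L)
      by (rewrite Csum_indicator; [rewrite Cexp_neg_0; ring|apply NoDup_nodup|trivial]).
    rewrite HhT.
    replace (Csub _ _) with
      (Csum (fun l => Cmul (Cexp_neg l s) (Csub (Csum ab (U l)) (delta0 l))) L).
    - apply Rle_trans with (1 := Cnorm_Csum _ _).
      replace rho with (Rsum (fun _ => rho / INR (length L)) L).
      + apply Rsum_le; intros l Hl; rewrite HU by trivial.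
        destruct (HU0 l (HLL l Hl)) as [_ [_ H]].
        rewrite Cnorm_mul; rewrite <- (Rmult_1_l (rho / _)).
        apply Rmult_le_compat; trivial using Cnorm_pos.
        apply exp_le_1; [lra|auto].
      + transitivity (rho / INR (length L) * INR (length L)); [|field; lra].
        apply Rsum_const.
    - rewrite <- Csum_sub; apply Csum_ext; intros l _.
      unfold delta0; destruct (Req_EM_T l 0), (Req_EM_T 0 l); try ring; exfalso; congruence. }
  assert (H2 : Cnorm (Csum h D) <= rho * B + A * rho).
  { apply Rle_trans with (Rsum (fun p => Cnorm (a (fst p)) * Cnorm (b (snd p))) D).
    - apply Rle_trans with (1 := Cnorm_Csum _ _), Rsum_le; intros p Hp.
      apply (fin_sub_in _ _ _ HDT), HTL in Hp.
      unfold h; rewrite Cnorm_mul; apply Rmult_le_compat; try apply Cnorm_pos.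
      + apply Hfa; tauto.
      + apply Hfb; tauto.
    - apply (product_of_tails_le b Fa Fb); trivial.
      + intros F HF Hd; apply Rle_trans with (2 := Hta F HF Hd), Rsum_le.
        intros l Hl; apply norm_le, (fin_sub_in _ _ _ HF Hl).
      + intros F HF Hd; apply Rle_trans with (2 := Htb F HF Hd), Rsum_le.
        intros l Hl; apply norm_le, (fin_sub_in _ _ _ HF Hl).
      + apply HDT.
      + intros p Hp; apply HTL, (fin_sub_in _ _ _ HDT Hp). }
  assert (H3 : Cnorm (Csum h Pd) <= (Cnorm z + rho) * B).
  { unfold h, Pd; rewrite Csum_list_prod, Cnorm_mul.
    apply Rmult_le_compat; try apply Cnorm_pos.
    - assert (H := has_sum_tail Lam _ fa
        (fun l Hl => term_le a s l (Rlt_le _ _ Hs) Hl) Fa rho z HFa Hta Hz).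
      replace (Csum fa Fa) with (Cadd z (Csub (Csum fa Fa) z)) by ring.
      apply Rle_trans with (1 := Cnorm_add _ _); lra.
    - apply Rle_trans with (1 := Cnorm_Csum _ _), Rle_trans with (Rsum (fun l => Cnorm (b l)) Fb).
      + apply Rsum_le; intros l Hl; apply Hfb, (fin_sub_in _ _ _ HFb Hl).
      + apply HB; [apply HFb|intros l Hl; exact (fin_sub_in _ _ _ HFb Hl)]. }
  rewrite (Csum_Permutation h _ _ HD), Csum_app in H1.
  assert (H4 : Cnorm C1 <= Cnorm (Csum h Pd) + Cnorm (Csum h D) +
             Cnorm (Csub (Cadd (Csum h Pd) (Csum h D)) C1)).
  { replace C1 with (Csub (Cadd (Csum h Pd) (Csum h D))
      (Csub (Cadd (Csum h Pd) (Csum h D)) C1)) at 1 by ring.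
    apply Rle_trans with (1 := Cnorm_sub _ _), Rplus_le_compat_r, Cnorm_add. }
  rewrite Cnorm_C1 in H4; nra.
Qed.

(** * Elements with transforms bounded away from 0 are invertible *)

Definition restriction (F : list R) : list (Cplx * R) := map (fun l => (a l, l)) F.

Lemma over_restriction (P : R -> Prop) (F : list R) : fin_sub P F -> over P (restriction F).
Proof.
  intros HF e He; apply in_map_iff in He; destruct He as [l [<- Hl]].
  exact (fin_sub_in _ _ _ HF Hl).
Qed.

Lemma nrm_restriction (F : list R) : nrm w (restriction F) = Rsum (fun l => Cnorm (a l) * w l) F.
Proof. unfold nrm, restriction; now rewrite Rsum_map. Qed.

Lemma restriction_diff (F0 F : list R) (rho : R) :
  fin_sub Lam F0 -> fin_sub Lam F -> incl F0 F ->
  tail_le Lam (fun l => Cnorm (a l) * w l) F0 rho ->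
  Rep Lam w (fun s => Csub (ev (restriction F) s) (ev (restriction F0) s)) rho.
Proof.
  intros HF0 HF Hi Ht; destruct (fin_sub_extend Lam F0 F HF0 HF Hi) as [D [HD [HDL Hd]]].
  exists (restriction D); repeat split.
  - intro s; unfold ev, restriction; rewrite !Csum_map; simpl.
    rewrite (Csum_Permutation _ _ _ HD), Csum_app; ring.
  - now apply over_restriction.
  - rewrite nrm_restriction; now apply Ht.
Qed.

(** [B] is the same for all [F] because each is a small perturbation of the restriction to [F0],
    whose exponents generate the semigroup on which the constant C is computed; the exponents of [F]
    itself may lie outside it. *)
Lemma restrictions_invertible :
  ~ closureC (tilde_image_H Lam a) C0 ->
  exists F0 B, fin_sub Lam F0 /\ forall F, fin_sub Lam F -> incl F0 F ->
    exists G, Rep Lam w G B /\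
      Rep Lam w (fun s => Csub C1 (Cmul (ev (restriction F) s) (G s))) (/ 2).
Proof.
  intro Hcl; apply not_all_ex_not in Hcl; destruct Hcl as [dl Hcl].
  apply imply_to_and in Hcl; destruct Hcl as [Hdl Hcl].
  assert (Hlow : forall s z, 0 < fst s -> tilde_at Lam a s z -> dl <= Cnorm z).
  { intros s z Hs Hz; apply Rnot_lt_le; intro H; apply Hcl; exists z; split.
    - exists s; now split.
    - now replace (Csub z C0) with z by ring. }
  (* One [rho] is lost by truncation and one by crossing the axis; what remains is D = 6 rho, and
     the later perturbations, of norm at most [rho], stay below D/4. *)
  set (rho := dl / 8); assert (Hrho : 0 < rho) by (unfold rho; lra).
  destruct (small_tail Lam _ Ha rho Hrho) as [F0 [HF0 Ht]].
  set (x := restriction F0); assert (Hx : over Lam x) by now apply over_restriction.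
  assert (Hright : forall sg t, 0 < sg -> dl - rho <= Cnorm (ev x (sg, t))).
  { intros sg t Hsg.
    assert (Hterm : forall l, Lam l ->
              Cnorm (Cmul (a l) (Cexp_neg l (sg, t))) <= Cnorm (a l) * w l)
      by (intros l Hl; apply term_le; trivial; simpl; lra).
    destruct (has_sum_exists Lam _ Ha _ Hterm) as [z Hz].
    assert (H := has_sum_tail Lam _ _ Hterm F0 rho z HF0 Ht Hz).
    specialize (Hlow (sg, t) z Hsg Hz).
    rewrite Cnorm_sub_sym in H.
    assert (H1 := Cnorm_sub_ge z (Csum (fun l => Cmul (a l) (Cexp_neg l (sg, t))) F0)).
    unfold ev, x, restriction; rewrite Csum_map; simpl; lra. }
  set (K := nrm (fun l => l * exp l) x).
  assert (HK : 0 <= K).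
  { apply Rsum_nonneg; intros e He; apply Rmult_le_pos; [apply Cnorm_pos|].
    apply Rmult_le_pos; [auto|apply Rlt_le, exp_pos]. }
  (* From abscissa [et] to any point at or right of -et on the nonpositive side is a move of at most
     2 et, which costs at most 2 et K <= rho. *)
  set (et := Rmin (/ 2) (rho / (2 * (K + 1)))).
  assert (Het : 0 < et <= / 2).
  { split; [|apply Rmin_l]; apply Rmin_glb_lt; [lra|apply Rdiv_lt_0_compat; lra]. }
  assert (HetK : 2 * et * K <= rho).
  { assert (H : et <= rho / (2 * (K + 1))) by apply Rmin_r.
    replace rho with (rho / (2 * (K + 1)) * (2 * (K + 1))) by (field; lra); nra. }
  set (D := dl - 2 * rho).
  assert (HD : 0 < D) by (unfold D, rho; lra).
  assert (HlowD : forall sg t, - et <= sg -> D <= Cnorm (ev x (sg, t))).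
  { intros sg t Hsg; unfold D; destruct (Rlt_le_dec 0 sg) as [H|H].
    - specialize (Hright sg t H); lra.
    - assert (H1 := Hright et t ltac:(lra)).
      assert (H2 := ev_horizontal x sg et t (fun e He => HLpos _ (Hx e He)) ltac:(lra)).
      assert (H3 := Cnorm_sub_ge (ev x (et, t)) (ev x (sg, t))).
      rewrite Cnorm_sub_sym in H3; fold K in H2; nra. }
  (* Generators must be positive for the geometric series to converge; 0 lies in [Gen L] anyway. *)
  set (L := filter (fun l => if Req_EM_T l 0 then false else true) F0).
  assert (HLL : forall l, In l L -> Lam l).
  { intros l Hl; apply filter_In in Hl; now apply (fin_sub_in Lam F0). }
  assert (HLp : forall l, In l L -> 0 < l).
  { intros l Hl; assert (H := HLpos l (HLL l Hl)); apply filter_In in Hl.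
    destruct Hl as [_ Hl]; destruct (Req_EM_T l 0); [discriminate|lra]. }
  assert (HGx : over (Gen L) x).
  { intros e He; apply in_map_iff in He; destruct He as [l [<- Hl]]; simpl.
    destruct (Req_EM_T l 0) as [->|Hl0]; [apply Gen_0|].
    apply Gen_in, filter_In; split; [trivial|destruct Req_EM_T; [contradiction|trivial]]. }
  assert (HGL : forall l, Gen L l -> Lam l).
  { intro l; apply Gen_sub; trivial; apply HLam. }
  assert (Hinv := approx_invertible_left L x D et HLp HGx HD Het HlowD).
  destruct (Gen_summable Lam (fun l => w l * expw et l) L) as [C HC]; trivial.
  { apply weighted_monoid_mul; trivial; apply expw_monoid; apply HLam. }
  { intros l Hl; apply admissible_growth with Lam; auto; lra. }
  exists F0, (4 * C / D); split; [trivial|]; intros F HF Hi.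
  destruct (change_of_weight (Gen L) Lam w (- et) C D (ev x)) with
    (d := fun s => Csub (ev x s) (ev (restriction F) s)) as [G [HG1 HG2]]; trivial.
  - apply expw_monoid; [apply Gen_0|apply Gen_add].
  - intro t; apply HlowD; lra.
  - apply Rep_le with rho; [unfold D, rho; lra|].
    eapply Rep_ext; [|exact (Rep_opp Lam w _ _ (restriction_diff F0 F rho HF0 HF Hi Ht))].
    intro s; cbv beta; unfold x; ring.
  - exists G; split; [trivial|].
    eapply Rep_ext; [|exact HG2]; intro s; cbv beta; ring.
Qed.

(** A geometric sum in the error 1 - p G, of norm at most 1/2, makes the error as small as desired
    while at most doubling the norm, so one bound holds for all [k]. *)
Lemma approximate_inverses :
  ~ closureC (tilde_image_H Lam a) C0 ->
  exists (B : R) (F : nat -> list R) (y : nat -> list (Cplx * R)), forall k,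
    fin_sub Lam (F k) /\ tail_le Lam (fun l => Cnorm (a l) * w l) (F k) (rate k) /\
    over Lam (y k) /\ nrm w (y k) <= B /\
    Rep Lam w (fun s => Csub C1 (Cmul (ev (restriction (F k)) s) (ev (y k) s))) (rate k).
Proof.
  intro Hcl; destruct (restrictions_invertible Hcl) as [F0 [B [HF0 HG]]].
  exists (B * / (1 - / 2)).
  destruct (choice (fun k (Fy : list R * list (Cplx * R)) =>
    fin_sub Lam (fst Fy) /\ tail_le Lam (fun l => Cnorm (a l) * w l) (fst Fy) (rate k) /\
    over Lam (snd Fy) /\ nrm w (snd Fy) <= B * / (1 - / 2) /\
    Rep Lam w (fun s => Csub C1 (Cmul (ev (restriction (fst Fy)) s) (ev (snd Fy) s))) (rate k)))
    as [Fy HFy].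
  - intro k.
    destruct (small_tail_above Lam _ Ha F0 (rate k) HF0 (rate_pos k)) as [F [HF [Hi Ht]]].
    destruct (HG F HF Hi) as [G [HG1 HG2]].
    destruct (pow_lt_1_zero (/ 2)) with (y := rate k) as [n Hn];
      [rewrite Rabs_right; lra|apply rate_pos|].
    specialize (Hn n (le_n n)); rewrite Rabs_right in Hn by (apply Rle_ge, pow_le; lra).
    set (r := fun s => Csub C1 (Cmul (ev (restriction F) s) (G s))).
    destruct (Rep_mul Lam w Hmon _ _ _ _ HG1
      (Rep_geo Lam w Hmon r (/ 2) n ltac:(lra) HG2)) as [y [Hy [HyL HyB]]].
    exists (F, y); simpl; split; [trivial|split; [trivial|split; [trivial|split; [trivial|]]]].
    apply Rep_le with ((/ 2) ^ n); [lra|].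
    eapply Rep_ext; [|exact (Rep_pow Lam w Hmon r (/ 2) n HG2)].
    intro s; cbv beta; rewrite <- Hy.
    transitivity (Csub C1 (Csub C1 (Cpw (r s) n))); [ring|].
    rewrite <- geo_eq; unfold r; ring.
  - exists (fun k => fst (Fy k)), (fun k => snd (Fy k)); exact HFy.
Qed.

Let coef_le (x : list (Cplx * R)) (B l : R) :
  over Lam x -> Rep Lam w (ev x) B -> Cnorm (coef x l) <= B.
Proof.
  intros Hx HB; destruct (classic (Lam l)) as [Hl|Hl].
  - apply Rle_trans with (1 := norm_le (coef x) l Hl).
    assert (H := Rep_coef Lam w Hmon x B (l :: nil) Hx HB).
    simpl in H; rewrite Rplus_0_r in H; apply H.
    + repeat constructor; auto.
    + now intros m [<-|[]].
  - rewrite (coef_notin Lam x l Hx Hl), Cnorm_C0; exact (Rep_pos Lam w Hmon _ _ HB).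
Qed.

Section Limit.
Variables (B : R) (F : nat -> list R) (y : nat -> list (Cplx * R)).
Hypothesis HFy : forall k,
  fin_sub Lam (F k) /\ tail_le Lam (fun l => Cnorm (a l) * w l) (F k) (rate k) /\
  over Lam (y k) /\ nrm w (y k) <= B /\
  Rep Lam w (fun s => Csub C1 (Cmul (ev (restriction (F k)) s) (ev (y k) s))) (rate k).

Let Rep_y (k : nat) : Rep Lam w (ev (y k)) B.
Proof. exists (y k); destruct (HFy k) as [_ [_ [H1 [H2 _]]]]; repeat split; trivial. Qed.

(* With [p_k = restriction (F k)],
   [y_k - y_n = y_k (1 - p_n y_n) - y_n (1 - p_k y_k) + y_k y_n (p_n - p_k)]. *)
Lemma approximate_inverses_cauchy (k n : nat) (l : R) :
  Cnorm (Csub (coef (y k) l) (coef (y n) l)) <= (B + B * B) * (rate k + rate n).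
Proof.
  destruct (HFy k) as [HFk [Htk [Hyk [_ Hk]]]], (HFy n) as [HFn [Htn [Hyn [_ Hn]]]].
  destruct (fin_sub_union Lam (F k) (F n) HFk HFn) as [U [HU [HkU HnU]]].
  assert (Hdk := restriction_diff (F k) U (rate k) HFk HU HkU Htk).
  assert (Hdn := restriction_diff (F n) U (rate n) HFn HU HnU Htn).
  replace (Csub _ _) with (coef (y k ++ oppx (y n)) l)
    by (rewrite coef_app, coef_opp; ring).
  apply coef_le.
  - intros e He; apply in_app_or in He; destruct He as [He|He]; [auto|].
    apply in_map_iff in He; destruct He as [e' [<- He']]; simpl; auto.
  - apply Rep_le with (B * rate n + B * rate k + B * B * (rate k + rate n)); [lra|].
    eapply Rep_ext; [|exact (Rep_add Lam w _ _ _ _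
      (Rep_sub Lam w _ _ _ _ (Rep_mul Lam w Hmon _ _ _ _ (Rep_y k) Hn)
        (Rep_mul Lam w Hmon _ _ _ _ (Rep_y n) Hk))
      (Rep_mul Lam w Hmon _ _ _ _ (Rep_mul Lam w Hmon _ _ _ _ (Rep_y k) (Rep_y n))
        (Rep_sub Lam w _ _ _ _ Hdk Hdn)))].
    intro s; cbv beta; rewrite ev_app, ev_opp; ring.
Qed.

Variables (E : R) (b : R -> Cplx).
Hypothesis Hb : forall l k, Cnorm (Csub (coef (y k) l) (b l)) <= E * rate k.

(** As in Fatou's lemma: on each finite set the coefficients converge, and the common bound [B]
    survives. *)
Lemma limit_in_Aw : in_Aw Lam w b.
Proof.
  exists B; intros G HG; apply Rle_plus_epsilon; intros eps Heps.
  destruct (rate_small (E * Rsum w G) eps Heps) as [k Hk]; specialize (Hk k (le_n k)).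
  destruct (HFy k) as [_ [_ [Hy _]]].
  assert (H := Rep_coef Lam w Hmon (y k) B G Hy (Rep_y k) (proj1 HG)
    (fun l Hl => fin_sub_in Lam G l HG Hl)).
  apply Rle_trans with (Rsum (fun l => Cnorm (coef (y k) l) * w l + E * rate k * w l) G).
  - apply Rsum_le; intros l Hl; rewrite <- Rmult_plus_distr_r; apply Rmult_le_compat_r.
    + assert (H1 := Hw1 l (fin_sub_in Lam G l HG Hl)); lra.
    + assert (H1 := Hb l k); assert (H2 := Cnorm_sub_ge (b l) (coef (y k) l)).
      rewrite Cnorm_sub_sym in H1; lra.
  - rewrite Rsum_add, Rsum_mul; nra.
Qed.

(** With a_k the restriction of [a] to [F k] and c the coefficients of y_k, a b - delta0 splits into
    a (b - c), (a - a_k) c and a_k c - delta0 as convolutions; at [l] these are at most E A, B and 1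
    times [rate k]. *)
Lemma limit_conv (l : R) : Lam l -> conv_at Lam a b l (delta0 l).
Proof.
  intros Hl eps Heps.
  destruct (summable_bound a Ha) as [A [HA0 HA]].
  destruct (rate_small (E * A + B + 1) (eps / 2)) as [k Hk]; [lra|].
  specialize (Hk k (le_n k)); destruct (HFy k) as [HFk [Htk [Hyk [_ Hrk]]]].
  assert (HE : 0 <= E * rate k) by exact (Rle_trans _ _ _ (Cnorm_pos _) (Hb l k)).
  set (c := coef (y k)).
  assert (Hc : forall m, Cnorm (c m) <= B) by (intro; apply coef_le; trivial).
  (* These pairs carry every nonzero term of a_k c at [l]; any larger set adds only terms in the
     tail of [a]. *)
  exists (map (fun m => (m, l - m))
    (filter (fun m => if excluded_middle_informative (Lam (l - m)) then true else false) (F k))).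
  split.
  { split.
    - apply Injective_map_NoDup; [intros m n Hmn; congruence|apply NoDup_filter, HFk].
    - apply Forall_forall; intros p Hp; apply in_map_iff in Hp; destruct Hp as [m [<- Hm]].
      apply filter_In in Hm; destruct Hm as [Hm Hlm]; simpl.
      destruct excluded_middle_informative; [|discriminate].
      repeat split; [exact (fin_sub_in _ _ _ HFk Hm)|trivial|ring]. }
  intros T HT Hincl.
  assert (HTl : forall p, In p T -> Lam (fst p) /\ Lam (snd p) /\ snd p = l - fst p).
  { intros p Hp; apply (fin_sub_in _ _ _ HT) in Hp; destruct Hp as [H1 [H2 H3]].
    repeat split; trivial; lra. }
  (* A pair with sum [l] is determined by its first coordinate, so the sum over [T] becomes a sum
     over [M]. *)
  set (M := map fst T).
  assert (HM : fin_sub Lam M).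
  { split.
    - apply Injective_map_NoDup_in; [|apply HT]; intros p q Hp Hq Hpq.
      destruct (HTl p Hp) as [_ [_ H1]], (HTl q Hq) as [_ [_ H2]].
      apply injective_projections; [trivial|rewrite H1, H2, Hpq; reflexivity].
    - apply Forall_forall; intros m Hm; apply in_map_iff in Hm; destruct Hm as [p [<- Hp]].
      now apply HTl. }
  assert (HFM : forall m, In m (F k) -> Lam (l - m) -> In m M).
  { intros m Hm Hlm; apply in_map_iff; exists (m, l - m); split; [trivial|].
    apply Hincl, in_map_iff; exists m; split; [trivial|]; apply filter_In; split; [trivial|].
    destruct excluded_middle_informative; [trivial|contradiction]. }
  set (ak := fun m => if excluded_middle_informative (In m (F k)) then a m else C0).
  set (g := fun m => Cmul (ak m) (c (l - m))).
  (* [M] and [F k] differ only where [g] vanishes: off [F k] by [ak], off [M] because l - m is then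
     not in [Lam]. *)
  assert (H3 : Csum g M = coef (mulx (restriction (F k)) (y k)) l).
  { transitivity (Csum g (F k)).
    - destruct (fin_sub_union Lam M (F k) HM HFk) as [U [HU [HMU HFU]]].
      transitivity (Csum g U); [|symmetry]; apply Csum_incl;
        try apply HM; try apply HU; try apply HFk; trivial.
      + intros m _ Hm; unfold g, ak; destruct excluded_middle_informative as [HmF|]; [|ring].
        unfold c; rewrite (coef_notin Lam (y k) (l - m) Hyk); [ring|].
        intro Hlm; apply Hm; auto.
      + intros m _ Hm; unfold g, ak; destruct excluded_middle_informative; [contradiction|ring].
    - rewrite coef_mulx; unfold restriction; rewrite Csum_map; simpl.
      apply Csum_ext; intros m Hm; unfold g, ak.
      destruct excluded_middle_informative; [reflexivity|contradiction]. }
  assert (H3' : Cnorm (Csub (Csum g M) (delta0 l)) <= rate k).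
  { rewrite H3, Cnorm_sub_sym.
    replace (Csub _ _) with (coef (((C1, 0) :: nil) ++ oppx (mulx (restriction (F k)) (y k))) l).
    - apply coef_le.
      + intros e He; apply in_app_or in He; destruct He as [[<-|[]]|He]; [apply HLam|].
        apply in_map_iff in He; destruct He as [e' [<- He]]; simpl.
        apply in_flat_map in He; destruct He as [e1 [He1 He]].
        apply in_map_iff in He; destruct He as [e2 [<- He2]]; simpl.
        apply HLam; [exact (over_restriction Lam (F k) HFk e1 He1)|auto].
      + eapply Rep_ext; [|exact Hrk]; intro s; cbv beta.
        rewrite ev_app, ev_opp, ev_mulx; unfold ev at 3; simpl; rewrite Cexp_neg_0; ring.
    - rewrite coef_app, coef_opp; unfold delta0, coef at 1; simpl.
      destruct (Req_EM_T 0 l), (Req_EM_T l 0); try ring; exfalso; congruence. }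
  assert (H1 : Cnorm (Csum (fun m => Cmul (a m) (Csub (b (l - m)) (c (l - m)))) M)
             <= E * rate k * A).
  { apply Rle_trans with (1 := Cnorm_Csum _ _),
      Rle_trans with (Rsum (fun m => E * rate k * Cnorm (a m)) M).
    - apply Rsum_le; intros m _; rewrite Cnorm_mul, Rmult_comm, Cnorm_sub_sym.
      apply Rmult_le_compat_r; [apply Cnorm_pos|apply Hb].
    - rewrite Rsum_mul; apply Rmult_le_compat_l; [trivial|].
      apply HA; [apply HM|intros m Hm; exact (fin_sub_in _ _ _ HM Hm)]. }
  assert (H2 : Cnorm (Csum (fun m => Cmul (Csub (a m) (ak m)) (c (l - m))) M) <= B * rate k).
  { apply Rle_trans with (1 := Cnorm_Csum _ _),
      Rle_trans with (Rsum (fun m => B * off (F k) (fun m => Cnorm (a m) * w m) m) M).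
    - apply Rsum_le; intros m Hm; rewrite Cnorm_mul, Rmult_comm; unfold off, ak.
      apply Rmult_le_compat; try apply Cnorm_pos; [apply Hc|].
      destruct excluded_middle_informative.
      + replace (Csub (a m) (a m)) with C0 by ring; rewrite Cnorm_C0; lra.
      + replace (Csub (a m) C0) with (a m) by ring.
        apply norm_le; exact (fin_sub_in _ _ _ HM Hm).
    - rewrite Rsum_mul; apply Rmult_le_compat_l.
      + exact (Rep_pos Lam w Hmon _ _ (Rep_y k)).
      + now apply (Rsum_off Lam). }
  replace (Csum _ T) with (Csum (fun m => Cmul (a m) (b (l - m))) M).
  2:{ unfold M; rewrite Csum_map; apply Csum_ext; intros p Hp.
      destruct (HTl p Hp) as [_ [_ ->]]; reflexivity. }
  rewrite (Csum_ext _ (fun m => Cadd (Cadd (Cmul (a m) (Csub (b (l - m)) (c (l - m))))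
    (Cmul (Csub (a m) (ak m)) (c (l - m)))) (g m))) by (intros m _; unfold g; ring).
  rewrite !Csum_add.
  match goal with |- Cnorm (Csub (Cadd ?u ?v) ?t) < _ =>
    replace (Csub (Cadd u v) t) with (Cadd u (Csub v t)) by ring end.
  apply Rle_lt_trans with (1 := Cnorm_add _ _).
  apply Rle_lt_trans with
    (1 := Rplus_le_compat_r _ _ _ (Cnorm_add _ _)); lra.
Qed.

End Limit.

Lemma not_closure_invertible :
  ~ closureC (tilde_image_H Lam a) C0 -> invertible_Aw Lam w a.
Proof.
  intro Hcl; destruct (approximate_inverses Hcl) as [B [F [y HFy]]].
  destruct (choice (fun l z => forall k,
    Cnorm (Csub (coef (y k) l) z) <= (B + B * B) * rate k)) as [b Hb].
  { intro l; apply (complete_rate (fun k => coef (y k) l)); intros k n.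
    now apply approximate_inverses_cauchy with F. }
  exists b; split; [now apply limit_in_Aw with B F y (B + B * B)|].
  now apply limit_conv with B F y (B + B * B).
Qed.

End Wiener.

Theorem theorem1 (Lam : R -> Prop) (w : R -> R)
  (HLam : semigroup0 Lam) (Hw : admissible Lam w) (a : R -> Cplx) :
  in_Aw Lam w a ->
  (invertible_Aw Lam w a <-> ~ closureC (tilde_image_H Lam a) C0).
Proof.
  intro Ha; split.
  - now apply invertible_not_closure.
  - now apply not_closure_invertible.
Qed.
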